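(* (i) Let $p$ and $q$ be two distributions on $\mathbb{R}^d$ and let $p_0$, $q_0$ be the distributions of $\boldsymbol{x}_0=\boldsymbol{t}(\boldsymbol{x})$ when $\boldsymbol{x}$ is drawn from $p$, $q$, respectively, where $\boldsymbol{t}$ is a continuously differentiable one-to-one map on $\mathbb{R}^d$. Assume $p$ is a positive, continuously differentiable density with Stein operator $\mathcal{P}$, and let $\mathcal{P}_0$ be the Stein operator of $p_0$. Then $$\mathbb{E}_{\boldsymbol{x}\sim q_0}\big[\mathcal{P}_0^\top\boldsymbol{\phi}_0(\boldsymbol{x})\big]=\mathbb{E}_{\boldsymbol{x}\sim q}\big[\mathcal{P}^\top\boldsymbol{\phi}(\boldsymbol{x})\big],\qquad\text{with}\qquad\boldsymbol{\phi}(\boldsymbol{x}):=\nabla\boldsymbol{t}(\boldsymbol{x})^{-1}\boldsymbol{\phi}_0(\boldsymbol{t}(\boldsymbol{x})),$$ where $\nabla\boldsymbol{t}$ is the Jacobian matrix of $\boldsymbol{t}$. (ii) Therefore, in the asymptotics of infinitesimal step size ($\epsilon\to0^+$), running Stein variational gradient descent (SVGD) with kernel $\boldsymbol{K}_0$ on $p_0$ is equivalent to running SVGD on $p$ with kernel $$\boldsymbol{K}(\boldsymbol{x},\boldsymbol{x}')=\nabla\boldsymbol{t}(\boldsymbol{x})^{-1}\,\boldsymbol{K}_0(\boldsymbol{t}(\boldsymbol{x}),\boldsymbol{t}(\boldsymbol{x}'))\,\nabla\boldsymbol{t}(\boldsymbol{x}')^{-\top},$$ in the sense that the trajectories of these two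 SVGD procedures can be mapped to each other by the one-to-one map $\boldsymbol{t}$ (and its inverse).
   Context: Here $\boldsymbol{\phi}_0\colon\mathbb{R}^d\to\mathbb{R}^d$ is a vector field, $\boldsymbol{K}_0\colon\mathbb{R}^d\times\mathbb{R}^d\to\mathbb{R}^{d\times d}$ is a matrix-valued positive definite kernel, and $A^{-\top}=(A^{-1})^\top$. Stein operator: the Stein operator $\mathcal{P}$ of a density $p$ acts on a vector field $\boldsymbol{\phi}=[\phi^1,\dots,\phi^d]^\top$ by $$\mathcal{P}^\top\boldsymbol{\phi}(\boldsymbol{x})=\nabla_{\boldsymbol{x}}\log p(\boldsymbol{x})^\top\boldsymbol{\phi}(\boldsymbol{x})+\sum_{\ell=1}^d\nabla_{x^\ell}\phi^\ell(\boldsymbol{x}),$$ where $x^\ell$ is the $\ell$-th coordinate of $\boldsymbol{x}$; $\mathcal{P}_0$ is defined in the same way with $p_0$ in place of $p$. A matrix-valued positive definite kernel is a function $\boldsymbol{K}\colon\mathbb{R}^d\times\mathbb{R}^d\to\mathbb{R}^{d\times d}$ with $\boldsymbol{K}(\boldsymbol{x},\boldsymbol{x}')=\boldsymbol{K}(\boldsymbol{x}',\boldsymbol{x})^\top$ and $\sum_{i,j}\boldsymbol{c}_i^\top\boldsymbol{K}(\boldsymbol{x}_i,\boldsymbol{x}_j)\boldsymbol{c}_j\ge0$ for any $\{\boldsymbol{x}_i\},\{\boldsymbol{c}_i\}\subset\mathbb{R}^d$. SVGD with matrix-valued kernel $\boldsymbol{K}$ on target density $p$: starting from a set of initial particles $\{\boldsymbol{x}_i\}_{i=1}^n\subset\mathbb{R}^d$,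 repeatedly apply, with step size $\epsilon$, the update $$\boldsymbol{x}_i\leftarrow\boldsymbol{x}_i+\frac{\epsilon}{n}\sum_{j=1}^n\Big[\boldsymbol{K}(\boldsymbol{x}_i,\boldsymbol{x}_j)\nabla_{\boldsymbol{x}_j}\log p(\boldsymbol{x}_j)+\boldsymbol{K}(\boldsymbol{x}_i,\boldsymbol{x}_j)\nabla_{\boldsymbol{x}_j}\Big],$$ where $\boldsymbol{K}(\cdot,\boldsymbol{x})\nabla_{\boldsymbol{x}}$ is the column vector with $\ell$-th element $\sum_{m=1}^d\nabla_{x^m}K_{\ell,m}(\cdot,\boldsymbol{x})$, $K_{\ell,m}$ being the $(\ell,m)$-element of $\boldsymbol{K}$ and the derivative being with respect to the second argument. SVGD on $p_0$ with kernel $\boldsymbol{K}_0$ is the same with $p_0$, $\boldsymbol{K}_0$ in place of $p$, $\boldsymbol{K}$. The update direction is, up to normalization, the maximizer of $\mathbb{E}_{\boldsymbol{x}\sim q}[\mathcal{P}^\top\boldsymbol{\phi}(\boldsymbol{x})]$ over the unit ball of the vector-valued reproducing kernel Hilbert space of $\boldsymbol{K}$, with $q$ the empirical distribution of the particles. *)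

(* Defs.v *)
From HB Require Import structures.
From mathcomp Require Import all_boot all_order all_algebra.
From mathcomp Require Import all_classical all_reals all_analysis.

Set Implicit Arguments.
Unset Strict Implicit.
Unset Printing Implicit Defensive.

Import Order.TTheory GRing.Theory Num.Theory.
Import numFieldNormedType.Exports.

Local Open Scope classical_set_scope.
Local Open Scope ring_scope.

(* The sigma-algebra generated by the coordinates, i.e. the Borel one; this is
   the same construction as the one of MathComp-Analysis on [n.-tuple]. *)
Section measurable_cV.
Context {R : realType}.
Variable d : nat.

Let coors : 'I_d -> 'cV[R]_d -> measurableTypeR R := fun i x => x i 0.

Let cV_set0 : g_sigma_preimage coors set0.
Proof. exact: sigma_algebra0. Qed.

Let cV_setC A : g_sigma_preimage coors A -> g_sigma_preimage coors (~` A).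
Proof. exact: sigma_algebraC. Qed.

Let cV_bigcup (F : _^nat) : (forall i, g_sigma_preimage coors (F i)) ->
  g_sigma_preimage coors (\bigcup_i (F i)).
Proof. exact: sigma_algebra_bigcup. Qed.

HB.instance Definition _ := @isMeasurable.Build
  default_measure_display
  'cV[R]_d (g_sigma_preimage coors) cV_set0 cV_setC cV_bigcup.

End measurable_cV.

Section measurable_cV_lemmas.
Context {R : realType}.

Lemma measurable_cV_coord d (i : 'I_d) :
  measurable_fun [set: 'cV[R]_d] (fun x => x i 0 : measurableTypeR R).
Proof.
move=> _ Y mY; rewrite setTI; apply: sub_sigma_algebra => /=.
rewrite -bigcup_seq/=; exists i => /=; first by rewrite mem_index_enum.
by exists Y => //; rewrite setTI.
Qed.

Lemma measurable_fun_cVP d dT (T : measurableType dT) (f : T -> 'cV[R]_d) :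
  (forall i, measurable_fun setT (fun x => f x i 0 : measurableTypeR R)) ->
  measurable_fun setT f.
Proof.
move=> mf.
suff H : g_sigma_preimage (fun i x => f x i 0 : measurableTypeR R) `<=`
    (measurable : set (set T)).
  move=> _ A mA; rewrite setTI; apply: H.
  rewrite (@g_sigma_preimage_comp _ (measurableTypeR R) d 'cV[R]_d
    (fun i x => x i 0) T f).
  by exists A => //; rewrite setTI.
apply: smallest_sub; first exact: sigma_algebra_measurable.
rewrite -bigcup_seq/= => A [i _ [B mB <-]].
exact: mf.
Qed.

End measurable_cV_lemmas.

Section lebesgue_cV.
Context {R : realType}.

Definition cons_cV d (z : measurableTypeR R * 'cV[R]_d) : 'cV[R]_d.+1 :=
  \col_i oapp (fun j => z.2 j 0) z.1 (unlift ord0 i).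

Definition uncons_cV d (x : 'cV[R]_d.+1) : measurableTypeR R * 'cV[R]_d :=
  (x ord0 0, \col_j x (lift ord0 j) 0).

Lemma cons_cVK d : cancel (@cons_cV d) (@uncons_cV d).
Proof.
move=> [a v]; rewrite /uncons_cV /cons_cV; congr pair.
  by rewrite mxE unlift_none.
by apply/colP => j; rewrite !mxE liftK.
Qed.

Lemma measurable_cons_cV d : measurable_fun setT (@cons_cV d).
Proof.
apply: measurable_fun_cVP => i.
case: (unliftP ord0 i) => [j ->|->].
  apply: (eq_measurable_fun
    ((fun x : 'cV[R]_d => x j 0 : measurableTypeR R) \o snd)).
    by move=> z _; rewrite /= mxE liftK.
  exact: measurableT_comp (measurable_cV_coord j) measurable_snd.
apply: (eq_measurable_fun fst); last exact: measurable_fst.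
by move=> z _; rewrite /= mxE unlift_none.
Qed.

Lemma measurable_uncons_cV d : measurable_fun setT (@uncons_cV d).
Proof.
apply: measurable_fun_pair; first exact: measurable_cV_coord.
apply: measurable_fun_cVP => j.
apply: (eq_measurable_fun
  (fun x : 'cV[R]_d.+1 => x (lift ord0 j) 0 : measurableTypeR R)).
  by move=> z _; rewrite /= mxE.
exact: measurable_cV_coord.
Qed.

Section step.
Variables (d : nat) (mu : {sigma_finite_measure set 'cV[R]_d -> \bar R}).

Definition lebesgue_cV_succ : set 'cV[R]_d.+1 -> \bar R :=
  pushforward (lebesgue_measure \x mu)%E (@cons_cV d).

Let nu : {measure set (measurableTypeR R * 'cV[R]_d)%type -> \bar R} :=
  (lebesgue_measure \x mu)%E.

Let succ0 : lebesgue_cV_succ set0 = 0%E.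
Proof. by rewrite /lebesgue_cV_succ /pushforward preimage_set0 measure0. Qed.

Let mpre A : measurable A -> measurable (@cons_cV d @^-1` A).
Proof.
by move=> mA; rewrite -[X in measurable X]setTI; exact: measurable_cons_cV.
Qed.

Let succ_ge0 A : (0 <= lebesgue_cV_succ A)%E.
Proof. exact: (measure_ge0 nu). Qed.

Let succ_sigma_additive : semi_sigma_additive lebesgue_cV_succ.
Proof.
move=> F mF tF mUF; rewrite /lebesgue_cV_succ /pushforward preimage_bigcup.
apply: (@measure_semi_sigma_additive _ _ _ nu).
- by move=> n; exact: mpre.
- apply/trivIsetP => /= i j _ _ ij; rewrite -preimage_setI.
  by move/trivIsetP : tF => /(_ _ _ _ _ ij) ->//; rewrite preimage_set0.
- by rewrite -preimage_bigcup; exact: mpre.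
Qed.

HB.instance Definition _ := isMeasure.Build _ _ _ lebesgue_cV_succ
  succ0 succ_ge0 succ_sigma_additive.

Let succ_sigma_finite : sigma_finite setT lebesgue_cV_succ.
Proof.
have /sigma_finiteP[F [TF ndF Foo]] := sigma_finiteT (@lebesgue_measure R).
have /sigma_finiteP[G [TG ndG Goo]] := sigma_finiteT mu.
exists (fun n => @uncons_cV d @^-1` (F n `*` G n)).
  rewrite -preimage_bigcup -[LHS](preimage_setT (@uncons_cV d)).
  congr (_ @^-1` _); rewrite -setXTT TF TG predeqE => -[x y]; split.
    move=> [/= [n _ Fnx] [k _ Gky]]; exists (maxn n k) => //; split.
    - by move: x Fnx; exact/subsetPset/ndF/leq_maxl.
    - by move: y Gky; exact/subsetPset/ndG/leq_maxr.
  by move=> [n _ []/= ? ?]; split; exists n.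
move=> k; have [mF Fk] := Foo k; have [mG Gk] := Goo k; split.
  by rewrite -[X in measurable X]setTI; apply: measurable_uncons_cV => //;
    exact: measurableX.
rewrite /lebesgue_cV_succ /pushforward -comp_preimage.
rewrite (_ : @uncons_cV d \o @cons_cV d = id) ?preimage_id; last first.
  by apply/funext => z /=; rewrite cons_cVK.
by rewrite product_measure1E// lte_mul_pinfty// ge0_fin_numE.
Qed.

HB.instance Definition _ := Measure_isSigmaFinite.Build _ _ _ lebesgue_cV_succ
  succ_sigma_finite.

End step.

Fixpoint lebesgue_cV d : {sigma_finite_measure set 'cV[R]_d -> \bar R} :=
  if d is d'.+1 then
    [the {sigma_finite_measure set _ -> \bar R} of
      lebesgue_cV_succ (lebesgue_cV d')]
  else [the {sigma_finite_measure set _ -> \bar R} of \d_ (0 : 'cV[R]_0)].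

Lemma lebesgue_cV_box d (a b : 'cV[R]_d) : (forall i, a i 0 <= b i 0) ->
  lebesgue_cV d [set x | forall i, x i 0 \in `[a i 0, b i 0]] =
  (\prod_(i < d) (b i 0 - a i 0))%:E.
Proof.
elim: d a b => [|d IHd] a b ab /=.
  by rewrite big_ord0 diracE mem_set// => -[].
rewrite /lebesgue_cV_succ /pushforward.
transitivity ((lebesgue_measure \x lebesgue_cV d)%E
    (`[a ord0 0, b ord0 0] `*` [set x : 'cV[R]_d |
      forall i, x i 0 \in `[(uncons_cV a).2 i 0, (uncons_cV b).2 i 0]])).
  congr (product_measure1 _ _ _); apply/seteqP; split => [[x v]|[x v]] /=.
    move=> H; split; first by have := H ord0; rewrite mxE unlift_none.
    by move=> i; have := H (lift ord0 i); rewrite !mxE liftK.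
  move=> [H1 H2] i; case: (unliftP ord0 i) => [j ->|->].
    by have := H2 j; rewrite !mxE liftK.
  by rewrite mxE unlift_none.
rewrite product_measure1E//=; last first.
  rewrite (_ : mkset _ = \big[setI/setT]_(i < d)
    ((fun x : 'cV[R]_d => x i 0 : measurableTypeR R) @^-1`
      `[(uncons_cV a).2 i 0, (uncons_cV b).2 i 0])).
    apply: bigsetI_measurable => i _.
    rewrite -[X in measurable X]setTI.
    by apply: measurable_cV_coord => //; exact: measurable_itv.
  rewrite -bigcap_seq; apply/seteqP; split => x /= H i; first by move=> _; exact: H.
  by apply: H; rewrite /= mem_index_enum.
rewrite lebesgue_measure_itv/= IHd; last by move=> i; rewrite !mxE.
rewrite big_ord_recl EFinM; congr (_ * _)%E; last first.
  by congr EFin; apply: eq_bigr => i _; rewrite !mxE.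
rewrite lte_fin; case: ltP => //= ba.
by rewrite (@le_anti _ _ (a ord0 0) (b ord0 0)) ?subrr// ab ba.
Qed.

End lebesgue_cV.

Definition is_density (R : realType) d (P : set 'cV[R]_d -> \bar R)
    (p : 'cV[R]_d -> R) : Prop :=
  [/\ measurable_fun setT p, forall x, 0 <= p x &
      forall A, measurable A -> P A = (\int[lebesgue_cV d]_(x in A) (p x)%:E)%E].

Section calculus.
Context {R : realType} {d : nat}.

Definition cvec (l : 'I_d) : 'cV[R]_d := delta_mx l 0.

Definition partial (V : normedModType R) (l : 'I_d) (f : 'cV[R]_d -> V) :
  'cV[R]_d -> V := fun x => 'D_(cvec l) f x.

Definition C1 (V : normedModType R) (f : 'cV[R]_d -> V) : Prop :=
  (forall x, differentiable f x) /\ (forall l, continuous (partial l f)).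

Definition grad (f : 'cV[R]_d -> R) (x : 'cV[R]_d) : 'cV[R]_d :=
  \col_l partial l f x.

Definition nabla (t : 'cV[R]_d -> 'cV[R]_d) (x : 'cV[R]_d) : 'M[R]_d :=
  \matrix_(k, l) partial l (fun y => t y k 0) x.

Definition divergence (phi : 'cV[R]_d -> 'cV[R]_d) (x : 'cV[R]_d) : R :=
  \sum_(l < d) partial l (fun y => phi y l 0) x.

Definition score (p : 'cV[R]_d -> R) : 'cV[R]_d -> 'cV[R]_d :=
  grad (fun x => ln (p x)).

Definition stein (p : 'cV[R]_d -> R) (phi : 'cV[R]_d -> 'cV[R]_d)
    (x : 'cV[R]_d) : R :=
  ((score p x)^T *m phi x) 0 0 + divergence phi x.

Definition pullback_field (t phi0 : 'cV[R]_d -> 'cV[R]_d) (x : 'cV[R]_d) :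
  'cV[R]_d := invmx (nabla t x) *m phi0 (t x).

End calculus.

Section svgd.
Context {R : realType} {d : nat}.

Definition matrix_kernel := 'cV[R]_d -> 'cV[R]_d -> 'M[R]_d.

Definition pd_kernel (K : matrix_kernel) : Prop :=
  (forall x x', K x x' = (K x' x)^T) /\
  (forall N (x c : 'I_N -> 'cV[R]_d),
    0 <= \sum_(i < N) \sum_(j < N) ((c i)^T *m K (x i) (x j) *m c j) 0 0).

Definition pullback_kernel (t : 'cV[R]_d -> 'cV[R]_d) (K0 : matrix_kernel) : matrix_kernel :=
  fun x x' => invmx (nabla t x) *m K0 (t x) (t x') *m (invmx (nabla t x'))^T.

(* The column vector K(x, y) nabla_y, with derivatives in the second argument. *)
Definition kernel_div (K : matrix_kernel) (x y : 'cV[R]_d) : 'cV[R]_d :=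
  \col_l \sum_(m < d) partial m (fun z => K x z l m) y.

Context {n : nat}.

(* A particle configuration is a d x n matrix, with the i-th particle as its
   i-th column. *)
Definition on_particles (f : 'cV[R]_d -> 'cV[R]_d) (X : 'M[R]_(d, n)) :
  'M[R]_(d, n) := \matrix_(l, i) f (col i X) l 0.

Definition svgd_direction (p : 'cV[R]_d -> R) (K : matrix_kernel) (X : 'M[R]_(d, n)) :
    'M[R]_(d, n) :=
  on_particles (fun y => n%:R^-1 *: \sum_(j < n)
    (K y (col j X) *m score p (col j X) + kernel_div K y (col j X))) X.

Definition svgd_step p K (eps : R) (X : 'M[R]_(d, n)) : 'M[R]_(d, n) :=
  X + eps *: svgd_direction p K X.

Definition svgd_run p K (eps : R) (X : 'M[R]_(d, n)) (k : nat) : 'M[R]_(d, n) :=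
  iter k (svgd_step p K eps) X.

(* The SVGD iterates with step eps, placed at the times k * eps, converge
   uniformly on [0, T] to the curve X as eps tends to 0+. *)
Definition svgd_limit p K (T : R) (X : R -> 'M[R]_(d, n)) : Prop :=
  {within `[0, T], continuous X} /\
  forall e : R, 0 < e -> \forall eps \near 0^'+, forall k : nat,
    k%:R * eps <= T -> `| svgd_run p K eps (X 0) k - X (k%:R * eps) | < e.

(* The differential equation obtained from the update when eps tends to 0+. *)
Definition svgd_flow p K (T : R) (X : R -> 'M[R]_(d, n)) : Prop :=
  {within `[0, T], continuous X} /\
  forall s, s \in `]0, T[ -> is_derive s 1 X (svgd_direction p K (X s)).

Definition locally_lipschitz (f : 'M[R]_(d, n) -> 'M[R]_(d, n)) : Prop :=
  [locally [lipschitz f X | X in setT]].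

End svgd.

Arguments matrix_kernel : clear implicits.

(* Main.v *)
(* Both sides of (i) agree pointwise: [stein p0 phi0 (t x) = stein p phi x].  As
   [t] is only [C1], the Jacobian cannot be differentiated, so neither a formula
   for the divergence of [phi] nor the change of variables theorem is used.
   Instead the identity is read off from test functions.  For bumps [psi] that
   shrink to [x], integration by parts against the first-order Taylor expansion
   of [p phi] gives
     [- \int grad psi . (p phi) / \int psi p  -->  div (p phi) x / p x = stein p phi x],
   and the same holds for [p0], [phi0], [psi \o tinv] at [t x].  The integrals
   on the two sides coincide because [P0] is the image of [P] and
   [grad (psi \o tinv) . phi0] at [t z] is [grad psi . phi] at [z].

   Applied to the rows of the kernels, this identity says that [t], acting on
   particles, maps the SVGD vector field of [p, K] to that of [p0, K0].  Since [t]
   is a [C1] diffeomorphism, one Euler step for one field is mapped to one Euler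
   step for the other up to [o(eps)], uniformly on compact sets, and a discrete
   Gronwall inequality for the field that is locally Lipschitz transfers the
   limits of the discrete trajectories. *)

From HB Require Import structures.
Require Import Defs.
From mathcomp Require Import all_boot all_order all_algebra.
From mathcomp Require Import all_classical all_reals all_analysis.
From mathcomp Require Import ring lra.

Set Implicit Arguments.
Unset Strict Implicit.
Unset Printing Implicit Defensive.

Import Order.TTheory GRing.Theory Num.Theory.
Import numFieldNormedType.Exports.

Local Open Scope classical_set_scope.
Local Open Scope ring_scope.
Import measurable_realfun.

(** * Strict differentiability and the inverse function theorem *)

(** Scaling explains why the test functions work. On a ball of radius [r] a bump has gradient
    [O(1/r)], the Taylor remainder of [p phi] is [o(r)] and the volume is [O(r^d)]; the error is
    thus [o(r^d)], against a mass of order [r^d]. Composition with [tinv] must preserve these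
    orders, which asks for a bound on the derivative of [tinv] at all points near [t x]. Strict
    differentiability provides it: derivatives at nearby points are automatically close to a strict
    derivative. The score of [p0] makes sense only where [p0] is positive. This is not assumed; it
    comes from the same asymptotics, applied to the zero field. For the trajectories, the obstacle
    is that a [C1] map transports the continuity of a vector field but not its Lipschitz constants,
    so Gronwall is available on one side only. The other Euler scheme is therefore conjugated into
    the space of the Lipschitz field and treated there as a perturbed one-step scheme. *)

Section matrix_norm.
Context {R : realType} {m n : nat}.
Implicit Types M : 'M[R]_(m, n).

Lemma mx_norm_entry M i j : `|M i j| <= `|M|.
Proof.
rewrite [leRHS]/Num.Def.normr /= mx_normrE.
exact: (le_bigmax _ (fun ij : 'I_m * 'I_n => `|M ij.1 ij.2|) (i, j)).
Qed.

Lemma mx_norm_le M (c : R) : 0 <= c -> (forall i j, `|M i j| <= c) -> `|M| <= c.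
Proof.
move=> c0 Mc; rewrite /Num.Def.normr /= mx_normrE.
by apply: bigmax_le => // -[i j] _ /=.
Qed.

End matrix_norm.

Lemma norm_col {R : realType} d n (X : 'M[R]_(d, n)) i : `|col i X| <= `|X|.
Proof. by apply: mx_norm_le => // k l; rewrite mxE; exact: mx_norm_entry. Qed.

Lemma norm_mulmx {R : realType} d n p (A : 'M[R]_(d, n)) (B : 'M[R]_(n, p)) :
  `|A *m B| <= n%:R * `|A| * `|B|.
Proof.
apply: mx_norm_le => [|i j]; first by rewrite !mulr_ge0.
rewrite mxE; apply: le_trans (ler_norm_sum _ _ _) _.
apply: (@le_trans _ _ (\sum_(k < n) `|A| * `|B|)).
  by apply: ler_sum => k _; rewrite normrM ler_pM// mx_norm_entry.
by rewrite sumr_const card_ord mulr_natl mulrnAl.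
Qed.

Lemma mulmx_bound {R : realType} d n (A : 'M[R]_(d, n)) :
  exists2 k : R, 0 < k & forall p (B : 'M[R]_(n, p)), `|A *m B| <= k * `|B|.
Proof.
exists (n%:R * `|A| + 1); first by rewrite ltr_wpDl// mulr_ge0.
move=> p B; apply: le_trans (norm_mulmx _ _) _.
by rewrite ler_wpM2r// lerDl.
Qed.

Lemma common_radius {R : realType} (I : finType) (P : I -> R -> Prop) :
  (forall i r r', r' <= r -> P i r -> P i r') ->
  (forall i, exists2 r : R, 0 < r & P i r) ->
  exists2 r : R, 0 < r & forall i, P i r.
Proof.
move=> Pm H; pose r i := sval (cid2 (H i)).
have r0 i : 0 < r i by rewrite /r; case: cid2.
have Pr i : P i (r i) by rewrite /r; case: cid2.
(* The seed 1 gives a positive radius even when [I] is empty. *)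
exists (\big[Num.min/1]_i r i).
  by apply: lt_bigmin.
by move=> i; apply: Pm (Pr i); exact: bigmin_le.
Qed.

Section strict_differentiability.
Context {R : realType}.
Implicit Types V W : normedModType R.

Lemma continuous_epsdelta V W (f : V -> W) x : {for x, continuous f} <->
  forall e : R, 0 < e -> exists2 r : R, 0 < r &
    forall y, `|y - x| < r -> `|f y - f x| < e.
Proof.
split=> [cf e e0|H].
  have /cvgrPdist_lt/(_ e e0)/nbhs_ballP[r r0 rP] := cf.
  exists r => // y yr; rewrite distrC; apply: rP.
  by rewrite -ball_normE /= distrC.
apply/cvgrPdist_lt => e e0; have [r r0 rP] := H e e0.
apply/nbhs_ballP; exists r => // y; rewrite -ball_normE /= distrC => yr.
by rewrite distrC rP.
Qed.

(* Strict differentiability: unlike [fdiff], it passes to an inverse map by a direct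
   estimate, with no continuity of the derivative. *)
Definition sdiff V W (f : V -> W) (x : V) (A : V -> W) : Prop :=
  forall e : R, 0 < e -> exists2 r : R, 0 < r &
    forall u v, `|u - x| < r -> `|v - x| < r ->
      `|f u - f v - A (u - v)| <= e * `|u - v|.

Definition fdiff V W (f : V -> W) (x : V) (A : V -> W) : Prop :=
  forall e : R, 0 < e -> exists2 r : R, 0 < r &
    forall h, `|h| < r -> `|f (x + h) - f x - A h| <= e * `|h|.

Lemma sdiff_fdiff V W (f : V -> W) x (A : V -> W) : sdiff f x A -> fdiff f x A.
Proof.
move=> fA e e0; have [r r0 H] := fA e e0; exists r => // h hr.
have -> : A h = A (x + h - x) by rewrite addrC addKr.
apply: le_trans (H _ _ _ _) _; rewrite ?subrr ?normr0//.
- by rewrite addrC addKr.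
- by rewrite addrC addKr.
Qed.

Lemma bounded_linear_continuous V W (f : {linear V -> W}) (k : R) :
  0 < k -> (forall v, `|f v| <= k * `|v|) -> continuous f.
Proof.
move=> k0 fk x; apply/cvgrPdist_lt => e e0.
apply/nbhs_ballP; exists (k^-1 * e); first by rewrite /= mulr_gt0 ?invr_gt0.
move=> y; rewrite -ball_normE /= => xy.
by rewrite -linearB; apply: le_lt_trans (fk _) _; rewrite -ltr_pdivlMl.
Qed.

Lemma differentiable_fdiff V W (f : V -> W) x :
  differentiable f x -> fdiff f x ('d f x).
Proof.
move=> df e e0; have /eqaddoP/(_ e e0) := diff_locally df.
move=> /nbhs_ballP[r r0 H]; exists r => // h hr.
have := H h; rewrite -ball_normE /= sub0r normrN => /(_ hr).
by rewrite !fctE /= (addrC h x) opprD addrA.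
Qed.

Lemma fdiff_differentiable V W (f : V -> W) x (A : {linear V -> W}) :
  continuous A -> fdiff f x A -> differentiable f x /\ 'd f x = A :> (V -> W).
Proof.
move=> cA fA.
have E : f \o shift x = cst (f x) + A +o_ (0 : V) id.
  apply/eqaddoP => e e0; have [r r0 H] := fA e e0.
  apply/nbhs_ballP; exists r => //= h; rewrite -ball_normE /= sub0r normrN => hr.
  by have := H h hr; rewrite !fctE /= (addrC x h) opprD addrA.
have D : 'd f x = A :> (V -> W) by exact: diff_unique.
by split=> //; apply/diff_locallyP; rewrite D; split.
Qed.

Lemma differentiable_translate V (v x : V) : differentiable (fun y => y + v) x.
Proof.
have -> : (fun y => y + v) = id + cst v by [].
exact: differentiableD.
Qed.

End strict_differentiability.

(** Takes the place of continuity of the derivative. Both approximations hold for a small multiple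
    [c *: h]: the one at [z] because [c *: h] is short, the strict one because [z] and [z + c *: h]
    both stay near [x]. Subtracting them compares [B] with [A] on [c *: h], and [c] cancels by
    linearity. *)
Lemma sdiff_near (R : realType) (V W : normedModType R) (f : V -> W) x (A : {linear V -> W}) :
  sdiff f x A -> forall e : R, 0 < e -> exists2 r : R, 0 < r &
    forall z (B : {linear V -> W}), `|z - x| < r -> fdiff f z B ->
    forall h, `|B h - A h| <= e * `|h|.
Proof.
move=> sf e e0; have e20 : 0 < e / 2 by rewrite divr_gt0.
have [r r0 Hr] := sf _ e20; exists r => // z B zr ff h.
have [s s0 Hs] := ff _ e20.
have [->|h0] := eqVneq h 0; first by rewrite (linear0 A) (linear0 B) subr0 !normr0 mulr0.
have nh : 0 < `|h| by rewrite normr_gt0.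
pose c := Num.min s (r - `|z - x|) / 2 / `|h|.
have m0 : 0 < Num.min s (r - `|z - x|) by rewrite lt_min s0 subr_gt0.
have c0 : 0 < c by rewrite !divr_gt0.
have ch : `|c *: h| < Num.min s (r - `|z - x|).
  by rewrite normrZ gtr0_norm// divfK ?gt_eqF// ltr_pdivrMr// ltr_pMr// ltr1n.
have [chs chr] : `|c *: h| < s /\ `|c *: h| < r - `|z - x|.
  by move: ch; rewrite lt_min => /andP.
clearbody c; have H1 := Hs _ chs.
have zc : `|z + c *: h - x| < r.
  rewrite addrAC; apply: le_lt_trans (ler_normD _ _) _.
  by rewrite -ltrBrDl.
have := Hr (z + c *: h) z zc zr; rewrite (addrC z) addrK => H2.
rewrite (addrC z) in H1.
have : `|c *: (B h - A h)| <= e * `|c *: h|.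
  rewrite scalerBr -!linearZ.
  have -> : B (c *: h) - A (c *: h) = (f (c *: h + z) - f z - A (c *: h))
      - (f (c *: h + z) - f z - B (c *: h)).
    by rewrite opprB [RHS]addrC subrKA.
  apply: le_trans (ler_normB _ _) _.
  by rewrite (splitr e) mulrDl lerD.
by rewrite !normrZ (gtr0_norm c0) mulrCA ler_pM2l.
Qed.

(** * Partial derivatives, and strict differentiability of [C1] maps *)

Section partial_derivatives.
Context {R : realType} {d : nat}.

Lemma cV_sum_cvec (h : 'cV[R]_d) : h = \sum_l h l 0 *: cvec l.
Proof.
rewrite [LHS]matrix_sum_delta; apply: eq_bigr => l _.
by rewrite big_ord1.
Qed.

Lemma diff_partial (W : normedModType R) (f : 'cV[R]_d -> W) x h :
  differentiable f x -> 'd f x h = \sum_l h l 0 *: partial l f x.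
Proof.
move=> df; rewrite {1}(cV_sum_cvec h) linear_sum; apply: eq_bigr => l _.
by rewrite linearZ /partial deriveE.
Qed.

Lemma partial_coord m n (t : 'cV[R]_d -> 'M[R]_(m, n)) l k j x :
  differentiable t x -> partial l (fun y => t y k j) x = partial l t x k j.
Proof.
move=> dt; rewrite /partial derive_mx ?mxE//; exact: diff_derivable.
Qed.

Lemma differentiable_entry (V : normedModType R) m n (t : V -> 'M[R]_(m, n)) x i j :
  differentiable t x -> differentiable (fun y => t y i j) x.
Proof.
move=> dt; apply: (differentiable_comp (g := fun M : 'M[R]_(m, n) => M i j) dt).
exact: differentiable_coord.
Qed.

Lemma mulmx_continuous n p (A : 'M[R]_(n, p)) q :
  continuous (mulmx A : 'M[R]_(p, q) -> 'M[R]_(n, q)).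
Proof.
have [k k0 Ak] := mulmx_bound A.
pose f : {linear 'M[R]_(p, q) -> 'M[R]_(n, q)} := mulmx A.
exact: (@bounded_linear_continuous R _ _ f k k0 (Ak q)).
Qed.

Lemma mean_value (f : 'cV[R]_d -> R) (u v : 'cV[R]_d) :
  (forall x, differentiable f x) ->
  exists2 c : R, c \in `]0, 1[ &
    f u - f v = \sum_l (u - v) l 0 * partial l f (v + c *: (u - v)).
Proof.
move=> df; pose g (s : R) := f (v + s *: (u - v)).
pose a (s : R) := v + s *: (u - v).
have da s : is_derive s (1 : R) a (u - v).
  have -> : a = cst v + (fun s : R => s *: (u - v)) by [].
  rewrite -[X in is_derive _ _ _ X]add0r; apply: is_deriveD.
  apply: DeriveDef; last by rewrite deriveE// diff_val scale1r.
  exact/diff_derivable.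
have dda s : differentiable a s by apply/derivable1_diffP; case: (da s).
have dg s : is_derive s (1 : R) g (\sum_l (u - v) l 0 * partial l f (a s)).
  have dgs : differentiable g s by exact: (differentiable_comp (dda s) (df (a s))).
  apply: DeriveDef; first exact: diff_derivable.
  rewrite deriveE// (diff_comp (dda s) (df (a s))) /= -(deriveE (1 : R) (dda s)).
  have -> : 'D_1 a s = u - v by apply: derive_val.
  by rewrite diff_partial.
have [|c c01] := @MVT R g (fun s => \sum_l (u - v) l 0 * partial l f (a s)) 0 1 ltr01 (fun s _ => dg s).
  apply: continuous_subspaceT => s; apply: differentiable_continuous.
  by apply/derivable1_diffP; case: (dg s).
rewrite subr0 mulr1 /g scale1r scale0r addr0 subrKC => E.
by exists c.
Qed.

Lemma C1_sdiff_real (f : 'cV[R]_d -> R) x : C1 f ->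
  sdiff f x (fun h => \sum_l h l 0 * partial l f x).
Proof.
move=> [df cf] e e0.
(* Each of the [d] coordinates gets an equal share; [d.+1] keeps the share positive in dimension
   0. *)
have e'0 : 0 < e / d.+1%:R by rewrite divr_gt0.
have [r r0 H] : exists2 r : R, 0 < r & forall l y, `|y - x| < r ->
    `|partial l f y - partial l f x| < e / d.+1%:R.
  apply: common_radius => [l r r' rr' H y yr|l]; first by apply/H/(lt_le_trans yr).
  exact: ((continuous_epsdelta (partial l f) x).1 (cf l x) _ e'0).
exists r => // u v ur vr.
have [c c01 ->] := mean_value u v df.
have yr : `|v + c *: (u - v) - x| < r.
  have -> : v + c *: (u - v) - x = (1 - c) *: (v - x) + c *: (u - x).
    apply/colP => i; rewrite !mxE; ring.
  move: c01; rewrite in_itv /= => /andP[c0 c1].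
  apply: le_lt_trans (ler_normD _ _) _; rewrite !normrZ.
  rewrite (gtr0_norm c0) gtr0_norm ?subr_gt0//.
  have -> : r = (1 - c) * r + c * r by ring.
  by apply: ltrD; rewrite ltr_pM2l// subr_gt0.
rewrite -sumrB; apply: le_trans (ler_norm_sum _ _ _) _.
apply: (@le_trans _ _ (\sum_(l < d) `|u - v| * (e / d.+1%:R))).
  apply: ler_sum => l _; rewrite -mulrBr normrM ler_pM ?mx_norm_entry//.
  by apply/ltW/H.
rewrite sumr_const card_ord -mulrnAr mulrC ler_wpM2r//.
rewrite -mulr_natr mulrAC -mulrA ler_piMr ?ltW//.
by rewrite ltr_pdivrMr// mul1r ltr_nat.
Qed.

Lemma C1_sdiff (t : 'cV[R]_d -> 'cV[R]_d) x : C1 t -> sdiff t x (mulmx (nabla t x)).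
Proof.
move=> [dt ct] e e0.
have [r r0 H] : exists2 r : R, 0 < r & forall k u v, `|u - x| < r -> `|v - x| < r ->
    `|t u k 0 - t v k 0 - \sum_l (u - v) l 0 * partial l (fun y => t y k 0) x|
      <= e * `|u - v|.
  apply: common_radius => [l r r' rr' H u v ur vr|k].
    by apply: H; [exact: lt_le_trans ur _|exact: lt_le_trans vr _].
  apply: (@C1_sdiff_real (fun y => t y k 0) x) => //; split=> [y|l].
    exact: differentiable_entry.
  rewrite (_ : partial _ _ = fun y => partial l t y k 0); last first.
    by apply/funext => y; rewrite partial_coord.
  move=> y; apply: (@continuous_comp _ _ _ (partial l t) (fun M => M k 0)).
    exact: ct.
  exact: coord_continuous.
exists r => // u v ur vr.
apply: mx_norm_le => [|k j]; first by rewrite mulr_ge0// ltW.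
rewrite ord1.
suff -> : (t u - t v - nabla t x *m (u - v)) k 0 = t u k 0 - t v k 0 -
    \sum_l (u - v) l 0 * partial l (fun y => t y k 0) x by exact: H.
rewrite !mxE; congr (_ - _); apply: eq_bigr => l _.
by rewrite !mxE mulrC.
Qed.

End partial_derivatives.

(** Joins completeness with the norm of matrices, for the fixed-point theorem on column vectors. *)
HB.instance Definition _ (R : realType) (m n : nat) := Complete.on 'M[R]_(m, n).

Section inverse_function.
Context {R : realType} {d : nat}.
Implicit Types (t : 'cV[R]_d -> 'cV[R]_d) (A : 'M[R]_d).

(* The Newton map [x |-> x - A^-1 (t x - y)] is a contraction near [x0]. *)
Lemma sdiff_locally_onto t x0 A : A \in unitmx -> sdiff t x0 (mulmx A) ->
  forall e : R, 0 < e -> exists2 s : R, 0 < s &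
    forall y, `|y - t x0| < s -> exists2 x, `|x - x0| < e & t x = y.
Proof.
move=> uA tA e e0; have [k k0 Bk] := mulmx_bound (invmx A).
(* With [k] a bound for the inverse of [A], this accuracy gives the Newton map the Lipschitz
   constant 1/2. *)
have k2 : 0 < (2 * k)^-1 by rewrite invr_gt0 mulr_gt0.
have [r r0 H] := tA _ k2.
pose q := Num.min r e / 2.
have q0 : 0 < q by rewrite divr_gt0// lt_min r0.
have qr : q < r.
  by rewrite ltr_pdivrMr// (le_lt_trans (y := r)) ?ge_min ?lexx// ltr_pMr// ltr1n.
have qe : q < e.
  by rewrite ltr_pdivrMr// (le_lt_trans (y := e)) ?ge_min ?lexx ?orbT// ltr_pMr// ltr1n.
(* For such [y] the Newton map moves [x0] by at most [q / 2]; contraction contributes another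
   [q / 2], so the ball [U] is mapped to itself. *)
exists (q / (2 * k)); first by rewrite divr_gt0// mulr_gt0.
move=> y yx0.
pose g x := x - invmx A *m (t x - y).
pose U := [set x : 'cV[R]_d | `|x - x0| <= q].
have gC u v : U u -> U v -> `|g u - g v| <= 2^-1 * `|u - v|.
  move=> Uu Uv.
  have -> : g u - g v = - (invmx A *m (t u - t v - A *m (u - v))).
    rewrite mulmxBr mulKmx// !mulmxBr /g !mulmxBr.
    by apply/colP => i; rewrite !mxE; ring.
  rewrite normrN; apply: le_trans (Bk _ _) _.
  rewrite -ler_pdivlMl//; apply: le_trans (H u v _ _) _.
  - exact: le_lt_trans Uu qr.
  - exact: le_lt_trans Uv qr.
  by rewrite invfM mulrA (mulrC k^-1).
have Ux0 : U x0 by rewrite /U /= subrr normr0 ltW.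
have gU : set_fun U U g.
  move=> x Ux; rewrite /U /=.
  have -> : g x - x0 = (g x - g x0) + (g x0 - x0) by rewrite subrKA.
  have -> : q = 2^-1 * q + 2^-1 * q by field.
  apply: le_trans (ler_normD _ _) _; apply: lerD.
    by apply: le_trans (gC _ _ Ux Ux0) _; rewrite ler_pM2l ?invr_gt0.
  have -> : g x0 - x0 = invmx A *m (y - t x0).
    by rewrite /g !mulmxBr; apply/colP => i; rewrite !mxE; ring.
  apply: le_trans (Bk _ _) _; rewrite -ler_pdivlMl//.
  apply: le_trans (ltW yx0) _.
  have kn0 : k != 0 by rewrite gt_eqF.
  by have -> : q / (2 * k) = k^-1 * (2^-1 * q) by field.
have U0 : U !=set0 by exists x0.
pose gf : {fun U >-> U} := HB.pack g (isFun.Build _ _ _ _ g gU).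
have [|||p Up pE] := @banach_fixed_point R 'cV[R]_d U gf.
- exists (2^-1)%:nng; split; first by rewrite /= invf_lt1// ltr1n.
  by move=> [u v] [Uu Uv] /=; exact: gC.
- have -> : U = closed_ball_ Num.norm x0 q.
    by apply/seteqP; split => x; rewrite /U /closed_ball_ /= distrC.
  exact: closed_closed_ball_.
- by exists x0.
exists p; first exact: le_lt_trans qe.
have : invmx A *m (t p - y) = 0.
  have : p - (p - invmx A *m (t p - y)) = 0 by rewrite -[X in p - X]pE subrr.
  by rewrite opprB addrC subrK.
move/(congr1 (mulmx A)); rewrite mulKVmx// mulmx0 => /eqP.
by rewrite subr_eq0 => /eqP.
Qed.

(** The linearization error of [tinv] is minus the inverse of [A] applied to that of [t]. It is
    small relative to [a - b], and [K2] turns this into small relative to [t a - t b]. The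
    hypothesis on preimages places [a] and [b] near [x0], which is continuity of [tinv] at
    [t x0]. *)
Lemma sdiff_inverse t tinv x0 A : cancel t tinv -> A \in unitmx ->
  sdiff t x0 (mulmx A) ->
  (forall e : R, 0 < e -> exists2 s : R, 0 < s &
    forall y, `|y - t x0| < s -> exists2 x, `|x - x0| < e & t x = y) ->
  sdiff tinv (t x0) (mulmx (invmx A)).
Proof.
move=> tK uA tA onto e e0; have [k k0 Bk] := mulmx_bound (invmx A).
(* The first bound lets half of [a - b] absorb the error and yields the Lipschitz constant [2 * k]
   of [K2]; the second makes [k * h * (2 * k)] at most [e]. *)
pose h := Num.min (2 * k)^-1 (e / (2 * k ^+ 2)).
have h0 : 0 < h by rewrite lt_min invr_gt0 divr_gt0 ?mulr_gt0// exprn_gt0.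
have [r r0 H] := tA _ h0; have [s s0 ontos] := onto _ r0.
exists s => // u v us vs.
have [a ar <-] := ontos u us; have [b br <-] := ontos v vs; rewrite !tK.
have Hab := H a b ar br.
have E : a - b - invmx A *m (t a - t b) = - (invmx A *m (t a - t b - A *m (a - b))).
  rewrite [in RHS]mulmxBr mulKmx// opprB //.
have K1 : `|a - b - invmx A *m (t a - t b)| <= k * (h * `|a - b|).
  by rewrite E normrN; apply: le_trans (Bk _ _) _; rewrite ler_pM2l.
have K2 : `|a - b| <= 2 * k * `|t a - t b|.
  have h1 : k * (h * `|a - b|) <= 2^-1 * `|a - b|.
    rewrite mulrA ler_wpM2r// -ler_pdivlMl//.
    by rewrite /h ge_min -invfM mulrC lexx.
  have := ler_normD (a - b - invmx A *m (t a - t b)) (invmx A *m (t a - t b)).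
  rewrite subrK => h2; have h3 := Bk _ (t a - t b).
  have := le_trans h2 (lerD (le_trans K1 h1) h3).
  rewrite -mulrA; move: (`|a - b|) (k * `|t a - t b|) => x y; lra.
apply: le_trans K1 _.
apply: (@le_trans _ _ (k * (e / (2 * k ^+ 2) * (2 * k * `|t a - t b|)))).
  rewrite ler_pM2l//; apply: ler_pM => //; first exact: ltW.
  by rewrite /h ge_min lexx orbT.
rewrite le_eqVlt; apply/orP; left; apply/eqP; field.
by rewrite gt_eqF.
Qed.

End inverse_function.

(** * Borel measurability and translation invariance *)

Section borel_cV.
Context {R : realType} {d : nat}.

Lemma open_ball_sub (V : normedModType R) (U : set V) x : open U -> U x ->
  exists2 r : R, 0 < r & forall y, `|y - x| < r -> U y.
Proof.
rewrite openE => /[apply] /nbhs_ballP[r r0 rU]; exists r => // y yr.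
by apply: rU; rewrite -ball_normE /= distrC.
Qed.

Let box (q : 'cV[rat]_d) (k : nat) :=
  [set x : 'cV[R]_d | forall i, `|x i 0 - ratr (q i 0)| < k.+1%:R^-1].

Let measurable_box q k : measurable (box q k).
Proof.
have -> : box q k = \bigcap_(i in [set` index_enum 'I_d])
    ((fun x : 'cV[R]_d => x i 0 : measurableTypeR R) @^-1`
      `]ratr (q i 0) - k.+1%:R^-1, ratr (q i 0) + k.+1%:R^-1[).
  apply/seteqP; split => [x H i _ /=|x H i].
    by rewrite in_itv /= -ltr_distlC distrC; exact: H.
  have := H i; rewrite /= mem_index_enum in_itv /= => /(_ isT).
  by rewrite -ltr_distlC distrC.
rewrite bigcap_seq; apply: bigsetI_measurable => i _.
rewrite -[X in measurable X]setTI.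
by apply: measurable_cV_coord => //; exact: measurable_itv.
Qed.

(** Boxes with rational centres and radii [k.+1%:R^-1] form a countable base; [F] enumerates those
    contained in [U] and puts the empty set elsewhere. *)
Lemma open_cV_measurable (U : set 'cV[R]_d) : open U -> measurable U.
Proof.
move=> oU.
pose F n := if unpickle n is Some (q, k) then
  if `[< box q k `<=` U >] then box q k else set0 else set0.
have -> : U = \bigcup_n F n.
  apply/seteqP; split => [x Ux|x [n _]]; last first.
    rewrite /F; case: unpickle => [[q k]|//].
    by case: asboolP => // + xb; apply.
  have [r r0 rU] := open_ball_sub oU Ux.
  have [k] : exists k, 0 + k.+1%:R^-1 < r / 2 by apply: ltr_add_invr; rewrite divr_gt0.
  rewrite add0r => kr.
  have H i : exists q : rat, `|x i 0 - ratr q| < k.+1%:R^-1.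
    have [q] := @rat_in_itvoo R (x i 0 - k.+1%:R^-1) (x i 0 + k.+1%:R^-1)
      ltac:(by rewrite ltrD2l gtrN ?invr_gt0).
    by rewrite in_itv /= -ltr_distlC; exists q.
  have [q qP] := choice H.
  pose qv : 'cV[rat]_d := \col_i q i.
  have xb : box qv k x by move=> i; rewrite mxE.
  exists (pickle (qv, k)) => //; rewrite /F pickleK; case: asboolP => // -[].
  move=> y yb; apply: rU.
  apply: (@le_lt_trans _ _ (2 * k.+1%:R^-1)); last by rewrite -ltr_pdivlMl// mulrC.
  apply: mx_norm_le => [|i j]; first by rewrite mulr_ge0.
  rewrite ord1 !mxE -[X in X - _](subrK (ratr (qv i 0))) -addrA.
  apply: le_trans (ler_normD _ _) _; rewrite mulrDl mul1r; apply: lerD.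
    exact/ltW/yb.
  by rewrite distrC; exact/ltW/xb.
apply: bigcupT_measurable => n; rewrite /F; case: unpickle => [[q k]|//].
by case: asboolP.
Qed.

Lemma continuous_cV_measurable (f : 'cV[R]_d -> R) :
  continuous f -> measurable_fun setT f.
Proof.
move=> /continuousP cf; apply: (measurability _ (RGenOpens.measurableE R)) => _ [_ [a [b ->] <-]].
by rewrite setTI; apply: open_cV_measurable; apply: cf; exact: interval_open.
Qed.

Lemma continuous_cV_measurable_map (t : 'cV[R]_d -> 'cV[R]_d) :
  continuous t -> measurable_fun setT t.
Proof.
move=> ct; apply: measurable_fun_cVP => i; apply: continuous_cV_measurable => x.
apply: (@continuous_comp _ _ _ t (fun M => M i 0)); first exact: ct.
exact: coord_continuous.
Qed.

Lemma differentiable_measurable (f : 'cV[R]_d -> R) :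
  (forall x, differentiable f x) -> measurable_fun setT f.
Proof.
move=> df; apply: continuous_cV_measurable => x.
exact: differentiable_continuous.
Qed.

(** Steps [n.+1%:R^-1] make partial derivatives limits of a sequence, as measurability and dominated
    convergence require. *)
Definition diffquo (l : 'I_d) (f : 'cV[R]_d -> R) (n : nat) (x : 'cV[R]_d) : R :=
  n.+1%:R * (f (x + n.+1%:R^-1 *: cvec l) - f x).

Lemma diffquo_cvg l (f : 'cV[R]_d -> R) x : differentiable f x ->
  diffquo l f ^~ x @ \oo --> partial l f x.
Proof.
move=> df; apply/cvgrPdist_le => e e0.
have [k k0 Bk] : exists2 k : R, 0 < k & `|cvec l : 'cV[R]_d| <= k.
  by exists (`|cvec l : 'cV[R]_d| + 1); rewrite ?ltr_wpDl// lerDl.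
have ek : 0 < e / k by rewrite divr_gt0.
have [r r0 H] := differentiable_fdiff df ek.
have rk : 0 < r / k by rewrite divr_gt0.
near=> n.
have nr : n.+1%:R^-1 < r / k by near: n; exact: (near_infty_natSinv_lt (PosNum rk)).
have n0 : 0 < (n.+1%:R : R)^-1 by rewrite invr_gt0.
have hn : `|n.+1%:R^-1 *: (cvec l : 'cV[R]_d)| <= n.+1%:R^-1 * k.
  by rewrite normrZ gtr0_norm// ler_pM2l.
have := H (n.+1%:R^-1 *: cvec l) _; rewrite linearZ /= -deriveE// -/(partial l f x).
rewrite (le_lt_trans hn) -?ltr_pdivlMr// => /(_ isT) H'.
have -> : partial l f x - diffquo l f n x = - (n.+1%:R *
    (f (x + n.+1%:R^-1 *: cvec l) - f x - n.+1%:R^-1 * partial l f x)).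
  by rewrite mulrBr mulVKf// opprB.
rewrite normrN normrM ger0_norm// -ler_pdivlMl//; apply: le_trans H' _.
by apply: le_trans (ler_wpM2l (ltW ek) hn) _; rewrite mulrCA divfK ?gt_eqF.
Unshelve. all: by end_near. Qed.

Lemma measurable_partial l (f : 'cV[R]_d -> R) :
  (forall x, differentiable f x) -> measurable_fun setT (partial l f).
Proof.
move=> df; apply: (@measurable_fun_cvg _ _ _ _ (diffquo l f)); last first.
  by move=> x _; exact: diffquo_cvg.
move=> n; apply: differentiable_measurable => x.
have H (c : R) v : differentiable (fun y => c * (f (y + v) - f y)) x.
  have dv : differentiable (fun y => f (y + v)) x.
    exact: (@differentiable_comp R _ _ _ (fun y : 'cV[R]_d => y + v) f x
      (@differentiable_translate R 'cV[R]_d v x) (df (x + v))).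
  exact: differentiableM (differentiable_cst c x) (differentiableB dv (df x)).
exact: H.
Qed.

End borel_cV.

Section translation.
Context {R : realType}.

Lemma lebesgue_measure_translate (a : R) (A : set (measurableTypeR R)) : measurable A ->
  lebesgue_measure ((fun x => x + a) @^-1` A) = lebesgue_measure A.
Proof.
move=> mA.
have mf : measurable_fun setT ((fun x => x + a) : measurableTypeR R -> measurableTypeR R).
  exact: measurable_funD.
pose nu : {measure set (measurableTypeR R) -> \bar R} :=
  measure_function_pushforward__canonical__measure_function_Measure lebesgue_measure mf.
apply/esym; apply: (@lebesgue_measure_unique R nu) => // X [[b c] _ <-] /=.
rewrite /nu /= /pushforward.
have -> : (fun x => x + a) @^-1` `]b, c]%classic = `]b - a, c - a]%classic.
  by apply/seteqP; split => x /=; rewrite !in_itv /= ltrBlDr lerBrDr.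
rewrite !lebesgue_measure_itv /= !lte_fin ltrD2r; case: ifPn => // _.
by congr EFin; rewrite opprB subrKA.
Qed.

Lemma ge0_integral_translateR (a : R) (f : measurableTypeR R -> \bar R) :
  measurable_fun setT f -> (forall x, 0 <= f x)%E ->
  (\int[lebesgue_measure]_x f (x + a)%R = \int[lebesgue_measure]_x f x)%E.
Proof.
move=> mf f0.
have mt : measurable_fun setT ((fun x => x + a) : measurableTypeR R -> measurableTypeR R).
  exact: measurable_funD.
have := @ge0_integral_pushforward _ _ _ _ R _ mt lebesgue_measure setT f measurableT mf (fun x _ => f0 x).
rewrite preimage_setT => <-.
pose nu : {measure set (measurableTypeR R) -> \bar R} :=
  measure_function_pushforward__canonical__measure_function_Measure lebesgue_measure mt.
apply: (@eq_measure_integral _ _ _ _ lebesgue_measure nu) => X mX _.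
exact: lebesgue_measure_translate.
Qed.

Lemma lebesgue_cV_translate d (v : 'cV[R]_d) (A : set 'cV[R]_d) : measurable A ->
  lebesgue_cV d ((fun x => x + v) @^-1` A) = lebesgue_cV d A.
Proof.
elim: d v A => [|d IH] v A mA /=.
  congr (_ _); apply/seteqP; split => x /=; rewrite (_ : x + v = x)//;
  by apply/colP => -[].
rewrite /lebesgue_cV_succ /pushforward /product_measure1; pose a := v ord0 0.
have mB : measurable (@cons_cV R d @^-1` A).
  by rewrite -[X in measurable X]setTI; exact: measurable_cons_cV.
set B := _ @^-1` A in mB *.
have mX : measurable_fun setT (lebesgue_cV d \o xsection B).
  exact: measurable_fun_xsection.
(* Over the first coordinate [x], the section of the translated set is the section of [B] at
   [x + a], translated by the remaining coordinates of [v]. The induction hypothesis treats the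
   section, one-dimensional invariance the outer integral. *)
transitivity (\int[lebesgue_measure]_x (lebesgue_cV d \o xsection B) ((x : measurableTypeR R) + a)%R)%E.
  apply: eq_integral => x _ /=; rewrite -[RHS](IH (uncons_cV v).2); last first.
    exact: measurable_xsection.
  congr (lebesgue_cV d _); apply/seteqP; split => w; rewrite /xsection /= !inE /B /=;
    rewrite (_ : cons_cV (x + a, w + (uncons_cV v).2) = cons_cV (x, w) + v)//;
    apply/colP => i; rewrite !mxE; case: unliftP => [j ->|->] //=; by rewrite !mxE.
exact: (@ge0_integral_translateR a (lebesgue_cV d \o xsection B) mX).
Qed.

Lemma ge0_integral_translate d (v : 'cV[R]_d) (f : 'cV[R]_d -> \bar R) :
  measurable_fun setT f -> (forall x, 0 <= f x)%E ->
  (\int[lebesgue_cV d]_x f (x + v)%R = \int[lebesgue_cV d]_x f x)%E.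
Proof.
move=> mf f0.
have mt : measurable_fun setT (fun x : 'cV[R]_d => x + v).
  apply: continuous_cV_measurable_map => x.
  exact: (differentiable_continuous (@differentiable_translate R 'cV[R]_d v x)).
have := @ge0_integral_pushforward _ _ _ _ R _ mt (lebesgue_cV d) setT f measurableT mf (fun x _ => f0 x).
rewrite preimage_setT => <-.
pose nu : {measure set 'cV[R]_d -> \bar R} :=
  measure_function_pushforward__canonical__measure_function_Measure (lebesgue_cV d) mt.
apply: (@eq_measure_integral _ _ _ _ (lebesgue_cV d) nu) => X mX _.
exact: lebesgue_cV_translate.
Qed.

End translation.

(** * Integration by parts against bump functions *)

Section local_integrals.
Context {R : realType} {d : nat}.
Implicit Types (f g psi : 'cV[R]_d -> R) (x y : 'cV[R]_d).
Local Notation leb := (lebesgue_cV d : {sigma_finite_measure set 'cV[R]_d -> \bar R}).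

Let cube y (s : R) := [set x : 'cV[R]_d | `|x - y| <= s].

(** The norm of column vectors is the sup norm, so its closed balls are boxes. *)
Lemma lebesgue_cV_cube y (s : R) : 0 <= s ->
  leb (cube y s) = ((2 * s) ^+ d)%:E.
Proof.
move=> s0; rewrite (_ : cube y s = [set x | forall i,
    x i 0 \in `[(y - const_mx s) i 0, (y + const_mx s) i 0]]).
  rewrite lebesgue_cV_box; last by move=> i; rewrite !mxE lerD2l (le_trans _ s0)// oppr_le0.
  congr EFin; rewrite -[RHS](_ : \prod_(i < d) (2 * s) = _); last first.
    by rewrite prodr_const card_ord.
  by apply: eq_bigr => i _; rewrite !mxE; ring.
apply/seteqP; split => x /=; rewrite /cube /=.
  move=> xy i; rewrite !mxE in_itv /= -ler_distlC distrC.
  have := mx_norm_entry (x - y) i 0; rewrite !mxE => /le_trans; exact.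
move=> H; apply: mx_norm_le => // i j; rewrite ord1.
by have := H i; rewrite !mxE in_itv /= -ler_distlC distrC.
Qed.

Lemma measurable_cube y (s : R) : measurable (cube y s).
Proof.
have c : continuous (fun x : 'cV[R]_d => `|x - y|).
  move=> x; apply: (@continuous_comp _ _ _ (fun x : 'cV[R]_d => x - y) Num.norm).
    exact: (differentiable_continuous (@differentiable_translate R 'cV[R]_d (- y) x)).
  exact: norm_continuous.
have -> : cube y s = (fun x : 'cV[R]_d => `|x - y|) @^-1` `]-oo, s]%classic.
  by apply/seteqP; split => x; rewrite /cube /= in_itv.
rewrite -[X in measurable X]setTI; exact: continuous_cV_measurable.
Qed.

Lemma bounded_support_integrable g (M : R) y (s : R) : 0 <= s ->
  measurable_fun setT g -> (forall x, `|g x| <= M) ->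
  (forall x, s < `|x - y| -> g x = 0) ->
  leb.-integrable setT (EFin \o g) /\ `|\int[leb]_x g x| <= M * (2 * s) ^+ d.
Proof.
move=> s0 mg gM gs.
have mC := measurable_cube y s.
have lC : (leb (cube y s) < +oo)%E by rewrite lebesgue_cV_cube// ltry.
have iC : leb.-integrable (cube y s) (EFin \o g).
  apply: measurable_bounded_integrable => //; first exact: measurable_funS mg.
  exists M; split; first exact: num_real.
  by move=> N /ltW MN x _; exact: le_trans (gM x) MN.
have gE : g \_ (cube y s) = g.
  apply/funext => x; rewrite /patch; case: ifPn => //; rewrite notin_setE => /negP.
  by rewrite -ltNge => /gs.
have EgE : (EFin \o g) \_ (cube y s) = EFin \o g by rewrite restrict_EFin gE.
split; first by rewrite -EgE; exact/(integrable_mkcond _ mC).1.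
have -> : \int[leb]_x g x = \int[leb]_(x in cube y s) g x.
  by rewrite [RHS]Rintegral_mkcond gE.
apply: le_trans (le_normr_Rintegral mC iC) _.
have -> : M * (2 * s) ^+ d = \int[leb]_(x in cube y s) (fun=> M) x.
  by rewrite Rintegral_cst//= [X in fine X](lebesgue_cV_cube y s0).
apply: le_Rintegral => //.
  have -> : EFin \o (fun x => `|g x|) = (fun x => `|(EFin \o g) x|)%E by [].
  exact: integrable_abse.
apply: measurable_bounded_integrable => //.
exists M; split; first exact: num_real.
move=> N /ltW MN x _ /=; apply: le_trans MN.
by rewrite ger0_norm// (le_trans (normr_ge0 _) (gM 0)).
Qed.

Lemma integral_translate g v : leb.-integrable setT (EFin \o g) ->
  (\int[leb]_x (g (x + v)%R)%:E = \int[leb]_x (g x)%:E)%E.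
Proof.
move=> /integrableP[mg _].
rewrite [LHS]integralE [RHS]integralE; congr (_ - _)%E.
  rewrite -[RHS](ge0_integral_translate v) => [||x]; last exact: funepos_ge0.
    by apply: eq_integral => x _; rewrite !funeposE.
  exact: measurable_funepos.
rewrite -[RHS](ge0_integral_translate v) => [||x]; last exact: funeneg_ge0.
  by apply: eq_integral => x _; rewrite !funenegE.
exact: measurable_funeneg.
Qed.

(** Radius and bounds are parameters because composition with [tinv] multiplies the radius and the
    gradient bound by constants. *)
Definition bump psi y (s B M : R) : Prop :=
  [/\ forall x, differentiable psi x, forall x, `|psi x| <= B,
      forall l x, `|partial l psi x| <= M &
      forall x, s < `|x - y| -> psi x = 0 /\ forall l, partial l psi x = 0].

Lemma norm_cvec (l : 'I_d) : `|cvec l : 'cV[R]_d| <= 1.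
Proof.
apply: mx_norm_le => // i j; rewrite !mxE.
by case: (_ && _); rewrite ?normr1 ?normr0.
Qed.

(** Every difference quotient integrates to 0 by translation invariance. By the mean value theorem
    the quotients are bounded by [M], and since their steps are at most 1 they vanish outside radius
    [s + 1]; dominated convergence passes to the partial derivative. *)
Lemma integral_partial_bump psi y (s B M : R) l : 0 <= s ->
  bump psi y s B M -> \int[leb]_x partial l psi x = 0.
Proof.
move=> s0 [dpsi psiB psiM psi0].
have mpsi := differentiable_measurable dpsi.
have [ipsi _] := bounded_support_integrable s0 mpsi psiB (fun x xs => (psi0 x xs).1).
have s1 : 0 <= s + 1 by rewrite addr_ge0.
have shiftE n x : diffquo l psi n x =
    n.+1%:R * psi (x + n.+1%:R^-1 *: cvec l) - n.+1%:R * psi x by rewrite /diffquo mulrBr.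
have dM n x : `|diffquo l psi n x| <= M.
  have [c _ E] := mean_value (x + n.+1%:R^-1 *: cvec l) x dpsi.
  rewrite /diffquo E addrC addKr (bigD1 l)//= big1 => [|i il]; last first.
    by rewrite !mxE (negbTE il) mulr0 mul0r.
  by rewrite !mxE !eqxx mulr1 addr0 mulrA mulfV// mul1r.
have d0 n x : s + 1 < `|x - y| -> diffquo l psi n x = 0.
  move=> xs; rewrite /diffquo (psi0 x _).1; last by apply: lt_trans xs; rewrite ltrDl.
  rewrite (psi0 (x + _) _).1 ?subrr ?mulr0//.
  have : `|x - y| <= `|x + n.+1%:R^-1 *: cvec l - y| + 1.
    have -> : x - y = (x + n.+1%:R^-1 *: cvec l - y) - n.+1%:R^-1 *: cvec l.
      by apply/colP => i; rewrite !mxE; ring.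
    apply: le_trans (ler_normB _ _) _; rewrite lerD2l normrZ gtr0_norm ?invr_gt0//.
    by rewrite mulr_ile1 ?norm_cvec// invf_le1// ler1n.
  by move=> /(lt_le_trans xs); rewrite ltrD2r.
have md n : measurable_fun setT (diffquo l psi n).
  apply: (@eq_measurable_fun _ _ _ _ _ (fun x =>
    n.+1%:R * psi (x + n.+1%:R^-1 *: cvec l) - n.+1%:R * psi x)).
    by move=> x _; rewrite shiftE.
  apply: measurable_funB; apply: measurable_funM => //.
  apply: measurableT_comp => //; apply: continuous_cV_measurable_map => x.
  exact: (differentiable_continuous (@differentiable_translate R 'cV[R]_d _ x)).
have int0 n : (\int[leb]_x (diffquo l psi n x)%:E = 0)%E.
  have it : leb.-integrable setT (EFin \o (fun x => psi (x + n.+1%:R^-1 *: cvec l))).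
    have [] // := @bounded_support_integrable (fun x => psi (x + n.+1%:R^-1 *: cvec l))
      B (y - n.+1%:R^-1 *: cvec l) s.
      apply: measurableT_comp => //; apply: continuous_cV_measurable_map => x.
      exact: (differentiable_continuous (@differentiable_translate R 'cV[R]_d _ x)).
    by move=> x; rewrite opprB addrA => xs; rewrite (psi0 _ xs).1.
  transitivity (\int[leb]_x (n.+1%:R%:E * ((psi (x + n.+1%:R^-1 *: cvec l)%R)%:E - (psi x)%:E)))%E.
    by apply: eq_integral.
  rewrite integralZl//; last by apply: integrableB => //; exact: ipsi.
  rewrite (integralB measurableT it ipsi).
  rewrite integral_translate//= subee ?mule0//.
  exact: integrable_fin_num ipsi.
have ig : leb.-integrable setT (EFin \o (fun x => M * \1_(cube y (s + 1)) x)).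
  have mC := measurable_cube y (s + 1).
  have [] // := @bounded_support_integrable (fun x => M * \1_(cube y (s + 1)) x) `|M| y (s + 1) s1.
  - by apply: measurable_funM => //; exact: measurable_indic.
  - by move=> x; rewrite indicE; case: (_ \in _); rewrite ?mulr1 ?mulr0 ?normr0.
  - by move=> x xs; rewrite indicE memNset ?mulr0// /cube /= leNgt xs.
have md' n : measurable_fun setT (fun x => (diffquo l psi n x)%:E).
  exact/measurable_EFinP.
have dcvg x : setT x -> (diffquo l psi n x)%:E @[n --> \oo] --> (EFin \o partial l psi) x.
  by move=> _; apply: cvg_EFin; [exact: nearW|exact: diffquo_cvg].
have dle n x : setT x ->
    (`|(diffquo l psi n x)%:E| <= (EFin \o (fun x => M * \1_(cube y (s + 1)) x)%R) x)%E.
  move=> _ /=; rewrite lee_fin indicE.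
  have [xs|] := boolP (x \in cube y (s + 1)); first by rewrite mulr1.
  rewrite notin_setE /cube /= => /negP; rewrite -ltNge => xs.
  by rewrite d0// normr0 mulr0.
have gfin x : setT x -> (EFin \o (fun x => M * \1_(cube y (s + 1)) x)%R) x \is a fin_num.
  by [].
have := @dominated_cvg _ _ _ leb setT measurableT _ _ _ md' dcvg gfin ig dle.
rewrite (_ : (fun n => _) = fun=> 0%E); last by apply/funext => n; exact: int0.
move/(cvg_lim (@ereal_hausdorff R)); rewrite lim_cst => [E|]; last exact: ereal_hausdorff.
by rewrite /Rintegral -E.
Qed.

Lemma partial_affine (A : {linear 'cV[R]_d -> R}) (c : R) y x : continuous A ->
  differentiable (fun z => c + A (z - y)) x /\
  forall l, partial l (fun z => c + A (z - y)) x = A (cvec l).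
Proof.
move=> cA.
have [D E] : differentiable (fun z => c + A (z - y)) x /\
    'd (fun z => c + A (z - y)) x = A :> (_ -> _).
  apply: fdiff_differentiable => // e e0; exists 1 => // h _.
  rewrite [X in `|X|](_ : _ = 0) ?normr0 ?mulr_ge0// ?ltW//.
  by rewrite !linearB linearD; ring.
by split=> // l; rewrite /partial deriveE// E.
Qed.

Lemma partialM f g x l : differentiable f x -> differentiable g x ->
  partial l (fun z => f z * g z) x = f x * partial l g x + g x * partial l f x.
Proof.
move=> df dg; rewrite /partial (deriveM (f := f) (g := g))//; exact: diff_derivable.
Qed.

(** The product of a bump and an affine function is again a bump, so its partial derivative
    integrates to 0; the product rule does the rest. *)
Lemma ibp_affine psi y (s B M : R) (A : {linear 'cV[R]_d -> R}) (c : R) l :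
  0 <= s -> bump psi y s B M -> continuous A ->
  leb.-integrable setT (EFin \o (fun x => partial l psi x * (c + A (x - y)))) /\
  \int[leb]_x (partial l psi x * (c + A (x - y))) = - A (cvec l) * \int[leb]_x psi x.
Proof.
move=> s0 bpsi cA; have [dpsi psiB psiM psi0] := bpsi.
have [k k0 Ak] := linear_lipschitz cA.
have B0 : 0 <= B by apply: le_trans (psiB 0).
have M0 : 0 <= M by apply: le_trans (psiM l 0).
pose g z := c + A (z - y).
have gdiff z : differentiable g z := (partial_affine c y z cA).1.
have gpart z l' : partial l' g z = A (cvec l') := (partial_affine c y z cA).2 l'.
have gb z : `|z - y| <= s -> `|g z| <= `|c| + k * s.
  move=> zs; apply: le_trans (ler_normD _ _) _; rewrite lerD2l.
  by apply: le_trans (Ak _) _; rewrite ler_pM2l.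
have L0 : 0 <= `|c| + k * s by rewrite addr_ge0// mulr_ge0// ltW.
have Ac l' : `|A (cvec l')| <= k.
  by apply: le_trans (Ak _) _; rewrite -[leRHS]mulr1 ler_pM2l// norm_cvec.
have pE l' x : partial l' (fun z => psi z * g z) x =
    psi x * A (cvec l') + g x * partial l' psi x.
  by rewrite partialM// gpart.
have bprod : bump (fun z => psi z * g z) y s (B * (`|c| + k * s))
    (B * k + (`|c| + k * s) * M).
  split.
  - by move=> x; apply: differentiableM.
  - move=> x; have [xs|xs] := leP `|x - y| s; last first.
      by rewrite (psi0 x xs).1 mul0r normr0 mulr_ge0.
    by rewrite normrM ler_pM// gb.
  - move=> l' x; rewrite pE; have [xs|xs] := leP `|x - y| s; last first.
      rewrite (psi0 x xs).1 (psi0 x xs).2 mul0r mulr0 addr0 normr0.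
      by rewrite addr_ge0// mulr_ge0// ltW.
    by apply: le_trans (ler_normD _ _) _; rewrite !normrM lerD// ler_pM// gb.
  - move=> x xs; rewrite (psi0 x xs).1 mul0r; split=> // l'.
    by rewrite pE (psi0 x xs).1 (psi0 x xs).2 mul0r mulr0 addr0.
have mpsi := differentiable_measurable dpsi.
have mg : measurable_fun setT g by apply: differentiable_measurable.
have mp := measurable_partial l dpsi.
have [ipsi _] := bounded_support_integrable s0 mpsi psiB (fun x xs => (psi0 x xs).1).
have [ipg _] : leb.-integrable setT (EFin \o (fun x => partial l psi x * g x)) /\
    `|\int[leb]_x (partial l psi x * g x)| <= M * (`|c| + k * s) * (2 * s) ^+ d.
  apply: (bounded_support_integrable (y := y)) => //.
  - exact: measurable_funM.
  - move=> x; have [xs|xs] := leP `|x - y| s; last first.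
      by rewrite (psi0 x xs).2 mul0r normr0 mulr_ge0.
    by rewrite normrM ler_pM// gb.
  - by move=> x xs; rewrite (psi0 x xs).2 mul0r.
split => //.
have := integral_partial_bump l s0 bprod.
under eq_Rintegral do rewrite pE mulrC (mulrC (g _)).
rewrite RintegralD//; last first.
  have -> : EFin \o (fun x => A (cvec l) * psi x) =
    (fun x => (A (cvec l))%:E * (EFin \o psi) x)%E by [].
  exact: integrableZl.
rewrite RintegralZl// => /eqP; rewrite addrC addr_eq0 => /eqP ->.
by rewrite mulNr.
Qed.

End local_integrals.

Lemma Rintegral_sum {R : realType} (dT : measure_display) (T : measurableType dT)
    (mu : {measure set T -> \bar R}) (I : finType) (h : I -> T -> R) :
  (forall k, mu.-integrable setT (EFin \o h k)) ->
  \int[mu]_x (\sum_k h k x) = \sum_k \int[mu]_x h k x.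
Proof.
move=> ih; rewrite /Rintegral.
under eq_integral do rewrite -sumEFin.
rewrite (@integral_sum _ _ _ mu setT measurableT _ (fun k => EFin \o h k))//.
under eq_bigr => k _ do rewrite -(fineK (integrable_fin_num measurableT (ih k))).
by rewrite sumEFin.
Qed.

(** * Expectations under a density and under an image measure *)

Section change_of_measure.
Context {R : realType} {d : nat}.
Local Notation leb := (lebesgue_cV d : {sigma_finite_measure set 'cV[R]_d -> \bar R}).

Lemma bounded_integrable_probability (P : probability 'cV[R]_d R) (g : 'cV[R]_d -> R) (M : R) :
  measurable_fun setT g -> (forall x, `|g x| <= M) -> P.-integrable setT (EFin \o g).
Proof.
move=> mg gM; apply: measurable_bounded_integrable => //.
  by rewrite ltey_eq fin_num_measure.
exists M; split; first exact: num_real.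
by move=> N /ltW MN x _; exact: le_trans (gM x) MN.
Qed.

(** [is_density] speaks of sets only. It identifies [p] almost everywhere with the Radon-Nikodym
    derivative, whose change of variables formula then covers functions. *)
Lemma integral_density (P : probability 'cV[R]_d R) p (g : 'cV[R]_d -> R) (M : R) :
  is_density P p -> measurable_fun setT g -> (forall x, `|g x| <= M) ->
  (\int[P]_x (g x)%:E = \int[leb]_x (g x * p x)%:E)%E.
Proof.
move=> [mp p0 Pp] mg gM.
have Pleb : P `<< leb.
  apply/null_content_dominatesP => A mA lA0; rewrite Pp//.
  by apply: null_set_integral => //; exact/measurable_EFinP/measurable_funTS.
have ip : leb.-integrable setT (EFin \o p).
  apply/integrableP; split; first exact/measurable_EFinP.
  have PT := Pp setT measurableT; rewrite probability_setT in PT.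
  rewrite (eq_integral (EFin \o p)) -?PT ?ltry// => x _ /=.
  by rewrite ger0_norm.
have E : ae_eq leb setT (Radon_Nikodym (charge_of_finite_measure P) leb) (EFin \o p).
  apply: integral_ae_eq => //.
  - exact: Radon_Nikodym_integrable.
  - exact/measurable_EFinP.
  - move=> A _ mA; rewrite -Radon_Nikodym_integral//=.
    exact: Pp.
rewrite -(@Radon_Nikodym_change_of_variables _ _ _ P leb Pleb (EFin \o g) setT)//; last first.
  exact: bounded_integrable_probability gM.
apply: ae_eq_integral => //.
- apply: emeasurable_funM; first exact/measurable_EFinP.
  by apply: measurable_int; exact: Radon_Nikodym_integrable.
- by apply/measurable_EFinP; exact: measurable_funM.
- by apply: filterS E => x /= /[apply] ->; rewrite EFinM.
Qed.

Lemma integral_image (t : 'cV[R]_d -> 'cV[R]_d) (Q Q0 : probability 'cV[R]_d R)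
    (f : 'cV[R]_d -> R) :
  measurable_fun setT t -> (forall A, measurable A -> Q0 A = pushforward Q t A) ->
  measurable_fun setT f -> (\int[Q0]_y (f y)%:E = \int[Q]_x (f (t x))%:E)%E.
Proof.
move=> mt Q0E mf.
have ge0 (g : 'cV[R]_d -> \bar R) : measurable_fun setT g -> (forall y, 0 <= g y)%E ->
    (\int[Q0]_y g y = \int[Q]_x g (t x))%E.
  move=> mg g0.
  have := @ge0_integral_pushforward _ _ _ _ R _ mt Q setT g measurableT mg (fun x _ => g0 x).
  rewrite preimage_setT => <-.
  pose nu : {measure set 'cV[R]_d -> \bar R} :=
    measure_function_pushforward__canonical__measure_function_Measure Q mt.
  apply: (@eq_measure_integral _ _ _ _ nu Q0) => X mX _.
  exact: Q0E.
rewrite [LHS]integralE [RHS]integralE; congr (_ - _)%E.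
  rewrite ge0; first by apply: eq_integral => x _; rewrite !funeposE.
    exact/measurable_funepos/measurable_EFinP.
  by move=> y; exact: funepos_ge0.
rewrite ge0; first by apply: eq_integral => x _; rewrite !funenegE.
  exact/measurable_funeneg/measurable_EFinP.
by move=> y; exact: funeneg_ge0.
Qed.

End change_of_measure.

Section local_asymptotics.
Context {R : realType} {d : nat}.
Implicit Types (f psi : 'cV[R]_d -> R) (y : 'cV[R]_d).
Local Notation leb := (lebesgue_cV d : {sigma_finite_measure set 'cV[R]_d -> \bar R}).

Lemma local_average f y (L : R) : 0 < L -> (forall x, differentiable f x) ->
  forall e : R, 0 < e -> exists2 rho : R, 0 < rho & forall r psi M, 0 < r -> r < rho ->
    bump psi y (L * r) 1 M ->
    `|\int[leb]_x (psi x * f x) - f y * \int[leb]_x psi x| <= e * r ^+ d.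
Proof.
move=> L0 df e e0.
have cf : {for y, continuous f} by exact: differentiable_continuous.
(* The support lies in a cube of volume [(2 * L) ^+ d * r ^+ d], which is divided out here. *)
pose e1 := e / (2 * L) ^+ d.
have e10 : 0 < e1 by rewrite divr_gt0// exprn_gt0// mulr_gt0.
have [s s0 Hs] := (continuous_epsdelta f y).1 cf _ e10.
exists (s / L); first by rewrite divr_gt0.
move=> r psi M r0 rs [dpsi psi1 psiM psi0].
have Lr0 : 0 <= L * r by rewrite ltW// mulr_gt0.
have mpsi := differentiable_measurable dpsi.
have mf := differentiable_measurable df.
have [ipsi _] := bounded_support_integrable Lr0 mpsi psi1 (fun x xs => (psi0 x xs).1).
have b x : `|psi x * (f x - f y)| <= e1.
  have [xs|xs] := leP `|x - y| (L * r); last first.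
    by rewrite (psi0 x xs).1 mul0r normr0 ltW.
  rewrite normrM -[leRHS]mul1r ler_pM//; apply/ltW/Hs.
  by apply: le_lt_trans xs _; rewrite mulrC -ltr_pdivlMr.
have [||i1 b1] := @bounded_support_integrable _ _ (fun x => psi x * (f x - f y)) e1 y (L * r) Lr0 _ b.
- by apply: measurable_funM => //; exact: measurable_funB.
- by move=> x xs; rewrite (psi0 x xs).1 mul0r.
have i2 : leb.-integrable setT (EFin \o (fun x => f y * psi x)).
  have -> : EFin \o (fun x => f y * psi x) = (fun x => (f y)%:E * (EFin \o psi) x)%E by [].
  exact: integrableZl.
rewrite (_ : \int[leb]_x (psi x * f x) =
    \int[leb]_x (psi x * (f x - f y) + f y * psi x)); last first.
  by apply: eq_Rintegral => x _; ring.
rewrite RintegralD// RintegralZl// addrK; apply: le_trans b1 _.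
by rewrite (mulrA 2) exprMn mulrA divfK// gt_eqF// exprn_gt0// mulr_gt0.
Qed.

(** The affine part of [f] at [y] is integrated exactly by [ibp_affine]. On the remainder the
    factors [C / r] and [e1 * (L * r)] multiply to a bound free of [r], and the volume of the
    support supplies [r ^+ d]. *)
Lemma local_integration_by_parts f y (L C : R) l : 0 < L -> 0 < C ->
  (forall x, differentiable f x) ->
  forall e : R, 0 < e -> exists2 rho : R, 0 < rho & forall r psi, 0 < r -> r < rho ->
    bump psi y (L * r) 1 (C / r) ->
    leb.-integrable setT (EFin \o (fun x => partial l psi x * f x)) /\
    `|\int[leb]_x (partial l psi x * f x) + partial l f y * \int[leb]_x psi x|
      <= e * r ^+ d.
Proof.
move=> L0 C0 df e e0.
pose e1 := e / (C * L * (2 * L) ^+ d).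
have K0 : 0 < C * L * (2 * L) ^+ d by rewrite !mulr_gt0// exprn_gt0// mulr_gt0.
have e10 : 0 < e1 by rewrite divr_gt0.
have [s s0 Hs] := differentiable_fdiff (df y) e10.
exists (s / L); first by rewrite divr_gt0.
move=> r psi r0 rs bpsi; have [dpsi psi1 psiM psi0] := bpsi.
have Lr0 : 0 <= L * r by rewrite ltW// mulr_gt0.
have mpsi := differentiable_measurable dpsi.
have mp := measurable_partial l dpsi.
have mf := differentiable_measurable df.
have cA : continuous ('d f y) by exact: diff_continuous.
have [i1 E1] := ibp_affine (f y) l Lr0 bpsi cA.
pose rem x := f x - (f y + 'd f y (x - y)).
have mrem : measurable_fun setT rem.
  apply: measurable_funB => //; apply: differentiable_measurable => x.
  exact: (partial_affine (f y) y x cA).1.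
have b x : `|partial l psi x * rem x| <= C * L * e1.
  have [xs|xs] := leP `|x - y| (L * r); last first.
    by rewrite (psi0 x xs).2 mul0r normr0 ltW//; apply/mulr_gt0 => //; exact: mulr_gt0.
  have := Hs (x - y); rewrite (le_lt_trans xs) => [/(_ isT)|]; last first.
    by rewrite mulrC -ltr_pdivlMr.
  rewrite subrKC -addrA -opprD -/(rem x) => H.
  rewrite normrM (_ : C * L * e1 = (C / r) * (e1 * (L * r))); last first.
    by field; rewrite gt_eqF.
  by rewrite ler_pM// (le_trans H)// ler_pM2l.
have [||i2 b2] := @bounded_support_integrable _ _ (fun x => partial l psi x * rem x) (C * L * e1) y (L * r) Lr0 _ b.
- exact: measurable_funM.
- by move=> x xs; rewrite (psi0 x xs).2 mul0r.
have fE : (fun x => partial l psi x * f x) =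
    (fun x => partial l psi x * rem x + partial l psi x * (f y + 'd f y (x - y))).
  by apply/funext => x; rewrite /rem; ring.
split.
  by rewrite fE; exact: (integrableD measurableT i2 i1).
rewrite fE RintegralD// E1 -deriveE// -/(partial l f y) mulNr subrK.
apply: le_trans b2 _.
rewrite (mulrA 2) exprMn mulrA (mulrAC (C * L)) (mulrC (C * L * _) e1).
by rewrite /e1 divfK// gt_eqF.
Qed.

End local_asymptotics.

(** * Construction of a bump with mass of order [r ^+ d] *)

Section bump_existence.
Context {R : realType} {d : nat}.
Implicit Types (x z : 'cV[R]_d).
Local Notation leb := (lebesgue_cV d : {sigma_finite_measure set 'cV[R]_d -> \bar R}).

Let sqplus (s : R) : R := Num.max 0 s ^+ 2.

Lemma differentiable_sqplus s : differentiable sqplus s /\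
  forall h, 'd sqplus s h = 2 * Num.max 0 s * h.
Proof.
pose A : {linear R -> R} := GRing.scale (2 * Num.max 0 s).
have cA : continuous A by exact: scaler_continuous.
have [D E] : differentiable sqplus s /\ 'd sqplus s = A :> (R -> R).
  apply: fdiff_differentiable => // e e0; exists e => // h he.
  (* The remainder is at most [h ^+ 2] in each of the four sign cases below, so [e] itself is a
     valid radius. *)
  apply: (@le_trans _ _ (h ^+ 2)); last first.
    by rewrite -real_normK ?num_real// expr2 ler_wpM2r// ltW.
  rewrite /A /sqplus /= /GRing.scale /=.
  have [s0|s0] := leP 0 s; have [sh0|sh0] := leP 0 (s + h); rewrite ler_norml; nra.
by split=> // h; rewrite E.
Qed.

(** The squared Euclidean distance is smooth, whereas the sup norm that defines the balls is not. *)
Let sqn x z := \sum_i (z i 0 - x i 0) * (z i 0 - x i 0).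

Let sqn_ge0 x z : 0 <= sqn x z.
Proof. by apply: sumr_ge0 => i _; rewrite -expr2 sqr_ge0. Qed.

Let sqn_le x z (r : R) : 0 <= r -> sqn x z <= r ^+ 2 -> forall i, `|z i 0 - x i 0| <= r.
Proof.
move=> r0 H i; rewrite -(@ler_pXn2r _ 2)// ?nnegrE// real_normK ?num_real//.
apply: le_trans H; rewrite /sqn (bigD1 i)//= -expr2 lerDl.
by apply: sumr_ge0 => j _; rewrite -expr2 sqr_ge0.
Qed.

Let coord_diff x i z : differentiable (fun z => z i 0 - x i 0 : R) z /\
  forall l, partial l (fun z => z i 0 - x i 0 : R) z = (l == i)%:R.
Proof.
have D : differentiable (fun z : 'cV[R]_d => z i 0 : R) z by exact: differentiable_coord.
have c : differentiable (cst (x i 0) : 'cV[R]_d -> R) z by exact: differentiable_cst.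
split; first exact: differentiableB.
move=> l; rewrite /partial (deriveB (f := fun z : 'cV[R]_d => z i 0 : R) (g := cst (x i 0))).
- rewrite derive_cst subr0 -[LHS]/(partial l (fun y : 'cV[R]_d => y i 0) z).
  rewrite (@partial_coord _ _ _ _ id)//.
  by rewrite /partial derive_id /cvec mxE eqxx andbT eq_sym.
- exact: diff_derivable.
- exact: diff_derivable.
Qed.

Let sqn_diff x z : differentiable (sqn x) z /\
  forall l, partial l (sqn x) z = 2 * (z l 0 - x l 0).
Proof.
pose h i z : R := (z i 0 - x i 0) * (z i 0 - x i 0).
have E : sqn x = \sum_(i < d) h i by apply/funext => w; rewrite fct_sumE.
have D i : differentiable (h i) z.
  by apply: differentiableM; exact: (coord_diff x i z).1.
split; first by rewrite E; exact: differentiable_sum.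
move=> l; rewrite E /partial derive_sum; last by move=> i; exact: diff_derivable.
rewrite (bigD1 l)//= big1 ?addr0 => [|i il].
  rewrite -/(partial l (h l) z) partialM ?(coord_diff x l z).2 ?eqxx; last 2 first.
  - exact: (coord_diff x l z).1.
  - exact: (coord_diff x l z).1.
  by rewrite /= mulr1; ring.
rewrite -/(partial l (h i) z) partialM ?(coord_diff x i z).2; last 2 first.
- exact: (coord_diff x i z).1.
- exact: (coord_diff x i z).1.
by rewrite eq_sym (negbTE il) mulr0 addr0.
Qed.

(* [psi z = max(0, 1 - |z - x|_2^2 / r^2)^2], differentiable across the boundary of
   its support thanks to the square. *)
Lemma exists_bump : exists2 c : R, 0 < c & forall x (r : R), 0 < r ->
  exists psi, [/\ bump psi x r 1 (4 / r), forall z, 0 <= psi z &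
    c * r ^+ d <= \int[leb]_z psi z].
Proof.
(* The bump is at least 1/4 on the cube of half-width [s = r / (2 * d.+1%:R)], where [q] is at least
   3/4; this cube has side [r / d.+1%:R]. *)
exists (4^-1 * (d.+1%:R^-1) ^+ d); first by rewrite mulr_gt0// exprn_gt0.
move=> x r r0; have r20 : 0 < r ^- 2 by rewrite invr_gt0 exprn_gt0.
pose q z := 1 - r ^- 2 * sqn x z.
have dq z : differentiable q z /\ forall l, partial l q z = - (r ^- 2 * (2 * (z l 0 - x l 0))).
  have [D E] := sqn_diff x z.
  have qE : q = cst 1 - (r ^- 2 *: sqn x) by [].
  have DZ : differentiable (r ^- 2 *: sqn x) z by exact: differentiableZ.
  split; first by rewrite qE; apply: differentiableB => //; exact: differentiable_cst.
  move=> l; rewrite qE /partial deriveB; last 2 first.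
  - exact: derivable_cst.
  - exact: diff_derivable.
  by rewrite derive_cst sub0r deriveZ ?[in LHS]/GRing.scale/= -?[X in _ * X]/(partial l (sqn x) z) ?E//; exact: diff_derivable.
have q1 z : q z <= 1 by rewrite /q gerBl mulr_ge0// ltW.
have qpos z : 0 < q z -> forall i, `|z i 0 - x i 0| <= r.
  rewrite /q subr_gt0 => H; apply: sqn_le (ltW r0) _.
  by move: H; rewrite mulrC ltr_pdivrMr ?exprn_gt0// mul1r => /ltW.
pose psi z := sqplus (q z).
have dpsi z : differentiable psi z /\
    forall l, partial l psi z = 2 * Num.max 0 (q z) * partial l q z.
  have [Dq _] := dq z; have [Ds Es] := differentiable_sqplus (q z).
  have D : differentiable psi z by exact: (differentiable_comp Dq Ds).
  split=> // l; rewrite /partial (deriveE _ D) (deriveE _ Dq) (diff_comp Dq Ds) /=.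
  exact: Es.
have supp z : r < `|z - x| -> Num.max 0 (q z) = 0.
  move=> zr; apply/max_idPl; rewrite leNgt; apply/negP => /qpos H.
  move: zr; rewrite ltNge; apply/negP; rewrite negbK.
  by apply: mx_norm_le (ltW r0) _ => i j; rewrite ord1 !mxE.
have m1 z : Num.max 0 (q z) <= 1 by rewrite ge_max ler01 q1.
have m0 z : 0 <= Num.max 0 (q z) by rewrite le_max lexx.
have psi0 z : 0 <= psi z by exact: sqr_ge0.
have bpsi : bump psi x r 1 (4 / r).
  split.
  - by move=> z; exact: (dpsi z).1.
  - by move=> z; rewrite ger0_norm// /psi /sqplus expr_le1.
  - move=> l z; rewrite (dpsi z).2 (dq z).2.
    have [qz|] := boolP (q z <= 0); last rewrite -ltNge => qz.
      by rewrite (max_idPl qz) mulr0 mul0r normr0 divr_ge0// ltW.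
    rewrite normrM normrN !normrM (ger0_norm (m0 z)) (gtr0_norm r20) !(ger0_norm (ler0n R 2)).
    (* Origin of [4 / r]: one factor 2 from the outer square, one from the squared distance, whose
       gradient is at most [2 * r] where [q] is positive. *)
    apply: (@le_trans _ _ (2 * 1 * (r ^- 2 * (2 * r)))).
      apply: ler_pM.
      - exact: mulr_ge0.
      - by rewrite !mulr_ge0 ?(ltW r20)//.
      - by rewrite ler_pM2l.
      - by rewrite ler_pM2l// ler_pM2l// qpos.
    by rewrite le_eqVlt; apply/orP; left; apply/eqP; field; rewrite gt_eqF.
  - move=> z zr; rewrite /psi /sqplus (supp z zr) expr0n /=; split=> // l.
    by rewrite -[X in partial _ X _]/psi (dpsi z).2 supp// mulr0 mul0r.
exists psi; split=> //.
have rn0 : r != 0 by rewrite gt_eqF.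
have dn0 : d.+1%:R != 0 :> R by [].
pose s := r / (2 * d.+1%:R).
have s0 : 0 < s by rewrite divr_gt0// mulr_gt0.
have mC := measurable_cube x s.
have lC : leb [set w : 'cV[R]_d | `|w - x| <= s] = ((2 * s) ^+ d)%:E.
  exact: lebesgue_cV_cube (ltW s0).
have psilow z : `|z - x| <= s -> 4^-1 <= psi z.
  move=> zs.
  have Nz : sqn x z <= d%:R * s ^+ 2.
    apply: (@le_trans _ _ (\sum_(i < d) s ^+ 2)); last first.
      by rewrite sumr_const card_ord mulr_natl.
    apply: ler_sum => i _; rewrite -expr2 -real_normK ?num_real//.
    rewrite ler_pXn2r ?nnegrE ?(ltW s0)//.
    by have := mx_norm_entry (z - x) i 0; rewrite !mxE => /le_trans; exact.
  have K : r ^- 2 * sqn x z <= 4^-1.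
    apply: (@le_trans _ _ (r ^- 2 * (d%:R * s ^+ 2))); first by rewrite ler_pM2l.
    have -> : r ^- 2 * (d%:R * s ^+ 2) = 4^-1 * (d%:R / d.+1%:R ^+ 2).
      rewrite /s; move: (d.+1%:R : R) dn0 => D dn0; field.
      by rewrite rn0 dn0.
    rewrite ler_piMr// ler_pdivrMr ?exprn_gt0// mul1r -natrX ler_nat.
    by rewrite (leq_trans (leqnSn d))// expnS expn1 leq_pmulr.
  rewrite /psi /sqplus max_r /q; nra.
have [ipsi _] : leb.-integrable setT (EFin \o psi) /\ `|\int[leb]_z psi z| <= 1 * (2 * r) ^+ d.
  have [D B _ S] := bpsi.
  apply: (bounded_support_integrable (y := x)) => //; first exact: ltW.
    exact: differentiable_measurable.
  by move=> z zr; exact: (S z zr).1.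
pose low z := 4^-1 * \1_([set w : 'cV[R]_d | `|w - x| <= s]) z : R.
have [ilow _] : leb.-integrable setT (EFin \o low) /\ `|\int[leb]_z low z| <= 4^-1 * (2 * s) ^+ d.
  apply: (bounded_support_integrable (y := x)) => //; first exact: ltW.
  - by apply: measurable_funM => //; exact: measurable_indic.
  - move=> z; rewrite /low indicE; case: (_ \in _); rewrite ?mulr1 ?mulr0 ?normr0//.
    by rewrite ger0_norm.
  - by move=> z zs; rewrite /low indicE memNset ?mulr0//= leNgt zs.
apply: (@le_trans _ _ (\int[leb]_z low z)).
  have iC : leb.-integrable setT (EFin \o \1_([set w : 'cV[R]_d | `|w - x| <= s])).
    apply/integrableP; split; first by apply/measurable_EFinP; exact: measurable_indic.
    rewrite (eq_integral (EFin \o \1_([set w : 'cV[R]_d | `|w - x| <= s]))) => [|z _ /=].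
      by rewrite integral_indic// setIT [X in (X < _)%E]lC ltry.
    by rewrite ger0_norm.
  rewrite /low RintegralZl// -mulrA ler_pM2l// /Rintegral integral_indic// setIT.
  rewrite [X in fine X]lC /= -exprMn.
  rewrite (_ : 2 * s = d.+1%:R^-1 * r)// /s.
  by move: (d.+1%:R : R) dn0 => D dn0; field.
apply: le_Rintegral => // z _; rewrite /low indicE.
have [|_] := boolP (z \in _); last by rewrite mulr0.
by rewrite inE mulr1 => /psilow.
Qed.

End bump_existence.

(** * Transport of the Stein operator *)

Section transport.
Context {R : realType} {d : nat}.
Variables (t tinv : 'cV[R]_d -> 'cV[R]_d).
Hypotheses (tK : cancel t tinv) (tinvK : cancel tinv t).
Hypotheses (tC1 : C1 t) (t_jac : forall x, nabla t x \in unitmx).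
Local Notation leb := (lebesgue_cV d : {sigma_finite_measure set 'cV[R]_d -> \bar R}).

Lemma sdiff_tinv x : sdiff tinv (t x) (mulmx (invmx (nabla t x))).
Proof.
have st := C1_sdiff x tC1.
apply: (sdiff_inverse tK (t_jac x) st).
exact: (sdiff_locally_onto (t_jac x) st).
Qed.

Lemma diff_tinv x : differentiable tinv (t x) /\
  'd tinv (t x) = mulmx (invmx (nabla t x)) :> ('cV[R]_d -> 'cV[R]_d).
Proof.
pose f : {linear 'cV[R]_d -> 'cV[R]_d} := mulmx (invmx (nabla t x)).
apply: (@fdiff_differentiable R _ _ tinv (t x) f).
  exact: mulmx_continuous.
exact: (sdiff_fdiff (@sdiff_tinv x)).
Qed.

Lemma continuous_t : continuous t.
Proof. by move=> x; apply: differentiable_continuous; exact: tC1.1. Qed.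

Lemma diff_comp_tinv (psi : 'cV[R]_d -> R) z : differentiable psi z ->
  differentiable (psi \o tinv) (t z) /\
  forall h, 'd (psi \o tinv) (t z) h = 'd psi z (invmx (nabla t z) *m h).
Proof.
move=> dpsi; have [D E] := diff_tinv z.
have dpsi' : differentiable psi (tinv (t z)) by rewrite tK.
split; first exact: differentiable_comp.
have := diff_comp D dpsi'; rewrite tK => C h.
transitivity ('d psi z ('d tinv (t z) h)); first exact: (congr1 (fun F => F h) C).
by rewrite E.
Qed.

(** [L] is a Lipschitz constant of [t] towards [x], read off from strict differentiability. [C] sums
    the [d] terms of the chain rule, each bounded through [sdiff_near] for [tinv]; its last 1 keeps
    it positive when [d] is 0. The bound on [r] keeps the image of the support inside the ball where
    [sdiff_near] applies. *)
Lemma bump_comp_tinv x : exists L C rho : R, [/\ 0 < L, 0 < C, 0 < rho &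
  forall r psi M, 0 < r -> r < rho -> bump psi x r 1 M ->
    bump (psi \o tinv) (t x) (L * r) 1 (C * M)].
Proof.
have [k k0 Hk] := mulmx_bound (nabla t x).
have [r1 r10 H1] := C1_sdiff x tC1 ltr01.
have [k' k'0 Hk'] := mulmx_bound (invmx (nabla t x)).
have [r2 r20 H2] := @sdiff_near R _ _ tinv (t x) (mulmx (invmx (nabla t x)))
  (@sdiff_tinv x) 1 ltr01.
have L0 : 0 < k + 1 by rewrite addr_gt0.
have K0 : 0 < k' + 1 by rewrite addr_gt0.
have C0 : 0 < d%:R * (k' + 1) + 1 by rewrite ltr_wpDl// mulr_ge0// ltW.
exists (k + 1), (d%:R * (k' + 1) + 1), (Num.min r1 (r2 / (k + 1))); split => //.
  by rewrite lt_min r10 divr_gt0.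
move=> r psi M r0; rewrite lt_min => /andP[rr1 rr2] [dpsi psi1 psiM psi0].
have tL z : `|z - x| <= r -> `|t z - t x| <= (k + 1) * r.
  move=> zr; apply: (@le_trans _ _ ((k + 1) * `|z - x|)); last by rewrite ler_pM2l.
  have := H1 z x (le_lt_trans zr rr1); rewrite subrr normr0 => /(_ r10) H.
  rewrite -(subrK (nabla t x *m (z - x)) (t z - t x)).
  apply: le_trans (ler_normD _ _) _; rewrite addrC mulrDl; apply: lerD => //.
have M0 (z : 'cV[R]_d) (l : 'I_d) : 0 <= M by exact: le_trans (normr_ge0 _) (psiM l z).
have pE l z : partial l (psi \o tinv) (t z) =
    \sum_k (invmx (nabla t z) *m cvec l) k 0 * partial k psi z.
  have [D E] := diff_comp_tinv (dpsi z).
  transitivity ('d (psi \o tinv) (t z) (cvec l)); first exact: deriveE.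
  by transitivity ('d psi z (invmx (nabla t z) *m cvec l)); [exact: E|exact: diff_partial].
split.
- by move=> y; rewrite -(tinvK y); exact: (diff_comp_tinv (dpsi _)).1.
- by move=> y; exact: psi1.
- move=> l y; rewrite -(tinvK y) pE; move: (tinv y) => {y} z.
  apply: le_trans (ler_norm_sum _ _ _) _.
  have [zr|zr] := leP `|z - x| r; last first.
    rewrite big1 ?mulr_ge0 ?(ltW C0) ?(M0 0 l)// => k1 _.
    by rewrite (psi0 z zr).2 mulr0 normr0.
  apply: (@le_trans _ _ (\sum_(k < d) (k' + 1) * M)); last first.
    rewrite sumr_const card_ord -mulrnAl -mulr_natl ler_wpM2r ?(M0 0 l)//.
    by rewrite lerDl.
  apply: ler_sum => k1 _; rewrite normrM ler_pM//.
  apply: le_trans (mx_norm_entry _ _ _) _.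
  have zr2 : `|t z - t x| < r2.
    by apply: le_lt_trans (tL z zr) _; rewrite mulrC -ltr_pdivlMr.
  have := H2 (t z) (mulmx (invmx (nabla t z))) zr2 (sdiff_fdiff (@sdiff_tinv z)) (cvec l).
  rewrite mul1r => H3; rewrite -(subrK (invmx (nabla t x) *m cvec l) (_ *m cvec l)).
  apply: le_trans (ler_normD _ _) _; rewrite addrC; apply: lerD.
    by apply: le_trans (Hk' _ _) _; rewrite -[leRHS]mulr1 ler_pM2l// norm_cvec.
  exact: le_trans H3 (norm_cvec l).
- move=> y; rewrite -(tinvK y); move: (tinv y) => {y} z zr.
  have {}zr : r < `|z - x|.
    by rewrite ltNge; apply: contraTN zr => /tL; rewrite -leNgt.
  rewrite /= tK (psi0 z zr).1; split=> // l; rewrite pE big1// => k1 _.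
  by rewrite (psi0 z zr).2 mulr0.
Qed.

Section densities.
Variables (P P0 : probability 'cV[R]_d R) (p p0 : 'cV[R]_d -> R).
Hypotheses (Pp : is_density P p) (p_gt0 : forall x, 0 < p x).
Hypotheses (p_diff : forall x, differentiable p x).
Hypotheses (P0E : forall A, measurable A -> P0 A = pushforward P t A).
Hypotheses (P0p0 : is_density P0 p0) (p0_diff : forall y, differentiable p0 y).

Let mt : measurable_fun setT t.
Proof. exact: continuous_cV_measurable_map continuous_t. Qed.

(** Both sides are expectations, of [g] under [P] and of [g0] under [P0], and [P0] is the image of
    [P]. *)
Lemma integral_change (g0 g : 'cV[R]_d -> R) (M : R) :
  measurable_fun setT g0 -> (forall y, `|g0 y| <= M) -> (forall x, g0 (t x) = g x) ->
  \int[leb]_x (g x * p x) = \int[leb]_y (g0 y * p0 y).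
Proof.
move=> mg gM gE.
have {}gE : g = g0 \o t by apply/funext => x; rewrite -gE.
have mg' : measurable_fun setT g by rewrite gE; exact: measurableT_comp.
rewrite /Rintegral -(integral_density (M := M) P0p0)//.
rewrite -(integral_density (M := M) Pp)//; last by move=> x; rewrite gE; exact: gM.
by rewrite (integral_image mt P0E mg) gE.
Qed.

(** [a] and [b] are the masses of a bump and of its image, divided by [r ^+ d]. Their ratio is
    unknown, so the second and third estimates must be used together to eliminate [b]; the bound
    [c <= a] prevents both from degenerating as [e] tends to 0. *)
Lemma density_stein_asymptotics (phi0 : 'cV[R]_d -> 'cV[R]_d) x :
  (forall y, differentiable phi0 y) ->
  (forall x, differentiable (pullback_field t phi0) x) ->
  exists2 c : R, 0 < c & forall e : R, 0 < e -> exists a b : R, [/\ c <= a,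
    `|p x * a - p0 (t x) * b| <= e &
    `|(\sum_k partial k (fun z => p z * pullback_field t phi0 z k 0) x) * a -
      (\sum_k partial k (fun z => p0 z * phi0 z k 0) (t x)) * b| <= e].
Proof.
move=> dphi0 dphi; have [c c0 Hbump] := @exists_bump R d.
exists c => // e e0.
have [L [C [rho [L0 C0 rho0 Hcomp]]]] := bump_comp_tinv x.
set y := t x in Hcomp *; set phi := pullback_field t phi0 in dphi *.
(* Half of [e] for each side of the transport, shared among the coordinates. *)
have e'0 : 0 < e / 2 / d.+1%:R by rewrite !divr_gt0.
have dF k z : differentiable (fun z => p z * phi z k 0) z.
  by apply: differentiableM => //; exact: differentiable_entry.
have dF0 k z : differentiable (fun z => p0 z * phi0 z k 0) z.
  by apply: differentiableM => //; exact: differentiable_entry.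
have [r1 r10 H1] : exists2 r1 : R, 0 < r1 & forall k r psi, 0 < r -> r < r1 ->
    bump psi x (1 * r) 1 (4 / r) ->
    leb.-integrable setT (EFin \o (fun z => partial k psi z * (p z * phi z k 0))) /\
    `|\int[leb]_z (partial k psi z * (p z * phi z k 0)) +
      partial k (fun z => p z * phi z k 0) x * \int[leb]_z psi z| <= e / 2 / d.+1%:R * r ^+ d.
  apply: common_radius => [k r r' rr' H s psi s0 sr|k].
    by apply: H => //; exact: lt_le_trans rr'.
  exact: (local_integration_by_parts x k ltr01 (C := 4)).
have C4 : 0 < C * 4 by rewrite mulr_gt0.
have [r2 r20 H2] : exists2 r2 : R, 0 < r2 & forall k r psi, 0 < r -> r < r2 ->
    bump psi y (L * r) 1 (C * 4 / r) ->
    leb.-integrable setT (EFin \o (fun z => partial k psi z * (p0 z * phi0 z k 0))) /\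
    `|\int[leb]_z (partial k psi z * (p0 z * phi0 z k 0)) +
      partial k (fun z => p0 z * phi0 z k 0) y * \int[leb]_z psi z| <= e / 2 / d.+1%:R * r ^+ d.
  apply: common_radius => [k r r' rr' H s psi s0 sr|k].
    by apply: H => //; exact: lt_le_trans rr'.
  exact: (local_integration_by_parts y k L0 C4).
have e20 : 0 < e / 2 by rewrite divr_gt0.
have [r3 r30 H3] := local_average x ltr01 p_diff e20.
have [r4 r40 H4] := local_average y L0 p0_diff e20.
have cphi0 : {for y, continuous phi0} by exact: differentiable_continuous.
have [r5 r50 H5] := (continuous_epsdelta phi0 y).1 cphi0 _ ltr01.
have r5L : 0 < r5 / L by rewrite divr_gt0.
near (0 : R)^'+ => r.
have r0 : 0 < r by near: r; exact: nbhs_right_gt.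
have rd0 : 0 < r ^+ d by rewrite exprn_gt0.
have [psi [bpsi psi_ge0 Ic]] := Hbump x r r0.
have bpsi0 : bump (psi \o tinv) y (L * r) 1 (C * (4 / r)).
  by apply: Hcomp => //; near: r; exact: nbhs_right_lt.
have bpsi1 : bump psi x (1 * r) 1 (4 / r) by rewrite mul1r.
have bpsi0' : bump (psi \o tinv) y (L * r) 1 (C * 4 / r) by rewrite -mulrA.
set psi0 := psi \o tinv in bpsi0 bpsi0'.
have rr1 : r < r1 by near: r; exact: nbhs_right_lt.
have rr2 : r < r2 by near: r; exact: nbhs_right_lt.
have rr3 : r < r3 by near: r; exact: nbhs_right_lt.
have rr4 : r < r4 by near: r; exact: nbhs_right_lt.
have rr5 : r < r5 / L by near: r; exact: nbhs_right_lt.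
have [dpsi0 psi01 psi0M psi00] := bpsi0.
have [dpsi _ _ _] := bpsi.
set I := \int[leb]_z psi z in Ic; pose I0 := \int[leb]_z psi0 z.
have E1 : \int[leb]_z (psi z * p z) = \int[leb]_z (psi0 z * p0 z).
  apply: (integral_change (M := 1)) => //; first exact: differentiable_measurable.
  by move=> z; rewrite /psi0 /= tK.
pose G z := \sum_k partial k psi z * phi z k 0.
pose G0 z := \sum_k partial k psi0 z * phi0 z k 0.
have GE z : G0 (t z) = G z.
  rewrite /G0 /G.
  have [D E] := diff_comp_tinv (dpsi z).
  (* Chain rule: the inverse Jacobian produced by [tinv] acts on [phi0 (t z)] and gives exactly
     [phi z]. *)
  transitivity ('d psi0 (t z) (phi0 (t z))).
    apply/esym; transitivity (\sum_k phi0 (t z) k 0 * partial k psi0 (t z)).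
      exact: diff_partial.
    by apply: eq_bigr => k _; rewrite mulrC.
  transitivity ('d psi z (phi z)); first exact: E.
  transitivity (\sum_k phi z k 0 * partial k psi z); first exact: diff_partial.
  by apply: eq_bigr => k _; rewrite mulrC.
have mG0 : measurable_fun setT G0.
  apply: measurable_sum => k; apply: measurable_funM.
    exact: measurable_partial.
  by apply: differentiable_measurable => z; exact: differentiable_entry.
(* [integral_change] asks for a bounded function, while [phi0] may be unbounded; on the support of
   [psi0] it stays within 1 of [phi0 y], because [L * r < r5]. *)
have G0M z : `|G0 z| <= \sum_(k < d) C * (4 / r) * (`|phi0 y| + 1).
  apply: le_trans (ler_norm_sum _ _ _) _; apply: ler_sum => k _.
  have [zr|zr] := leP `|z - y| (L * r); last first.
    by rewrite (psi00 z zr).2 mul0r normr0 !mulr_ge0 ?invr_ge0 ?ltW// ltr_wpDl.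
  rewrite normrM ler_pM//; apply: le_trans (mx_norm_entry _ _ _) _.
  have := H5 z; rewrite (le_lt_trans zr) => [/(_ isT)/ltW H|]; last first.
    by rewrite mulrC -ltr_pdivlMr.
  rewrite -(subrK (phi0 y) (phi0 z)); apply: le_trans (ler_normD _ _) _.
  by rewrite addrC lerD2l.
have E2 : \sum_k \int[leb]_z (partial k psi z * (p z * phi z k 0)) =
    \sum_k \int[leb]_z (partial k psi0 z * (p0 z * phi0 z k 0)).
  rewrite -Rintegral_sum => [|k]; last by case: (H1 k r psi r0 rr1 bpsi1).
  rewrite -Rintegral_sum => [|k]; last by case: (H2 k r psi0 r0 rr2 bpsi0').
  transitivity (\int[leb]_z (G z * p z)).
    by apply: eq_Rintegral => z _; rewrite mulr_suml; apply: eq_bigr => k _; ring.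
  rewrite (integral_change mG0 G0M GE).
  by apply: eq_Rintegral => z _; rewrite mulr_suml; apply: eq_bigr => k _; ring.
have sum_bound (u v : 'I_d -> R) (J : R) :
    (forall k, `|u k + v k * J| <= e / 2 / d.+1%:R * r ^+ d) ->
    `|\sum_k u k + (\sum_k v k) * J| <= e / 2 * r ^+ d.
  move=> H; rewrite mulr_suml -big_split /=; apply: le_trans (ler_norm_sum _ _ _) _.
  apply: (@le_trans _ _ (\sum_(k < d) e / 2 / d.+1%:R * r ^+ d)).
    by apply: ler_sum => k _; exact: H.
  rewrite sumr_const card_ord -(mulr_natr _ d) mulrAC ler_pM2r//.
  by rewrite (mulrAC _ d.+1%:R^-1) ler_pdivrMr// ler_pM2l// ler_nat.
have B1 := sum_bound _ _ I (fun k => (H1 k r psi r0 rr1 bpsi1).2).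
have B2 := sum_bound _ _ I0 (fun k => (H2 k r psi0 r0 rr2 bpsi0').2).
have B3 := H3 r psi _ r0 rr3 bpsi1.
have B4 := H4 r psi0 _ r0 rr4 bpsi0'.
exists (I / r ^+ d), (I0 / r ^+ d); split.
- by rewrite ler_pdivlMr.
- rewrite !mulrA -mulrBl normrM normfV (gtr0_norm rd0) ler_pdivrMr//.
  rewrite E1 in B3; move: B3 B4; rewrite -/I -/I0.
  by rewrite !ler_norml => /andP[? ?] /andP[? ?]; apply/andP; split; lra.
- rewrite !mulrA -mulrBl normrM normfV (gtr0_norm rd0) ler_pdivrMr//.
  rewrite E2 in B1; move: B1 B2.
  set X1 := _ * I; set X2 := _ * I0; set X3 := \sum_k _.
  by rewrite !ler_norml => /andP[? ?] /andP[? ?]; apply/andP; split; lra.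
Unshelve. all: by end_near. Qed.

End densities.
End transport.

Section stein.
Context {R : realType} {d : nat}.

Lemma partial_ln (p : 'cV[R]_d -> R) x l : differentiable p x -> 0 < p x ->
  differentiable (fun y => ln (p y)) x /\
  partial l (fun y => ln (p y)) x = (p x)^-1 * partial l p x.
Proof.
move=> dp px.
have dln : differentiable (@ln R) (p x).
  by apply/derivable1_diffP; case: (is_derive1_ln px).
have D : differentiable (@ln R \o p) x by exact: differentiable_comp.
split; first exact: D.
rewrite /partial -[LHS]/('D_(cvec l) (@ln R \o p) x) (deriveE _ D).
have := diff_comp dp dln => C.
transitivity ('d (@ln R) (p x) ('d p x (cvec l))); first exact: (congr1 (fun F => F _) C).
rewrite -[X in 'd (@ln R) _ X]mulr1 -[_ * 1]/(('d p x (cvec l)) *: (1 : R)) linearZ /=.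
rewrite -(deriveE (1 : R) dln) (deriveE _ dp).
have -> : 'D_1 (@ln R) (p x) = (p x)^-1.
  by have H := is_derive1_ln px; rewrite derive_val.
by rewrite /GRing.scale /= mulrC.
Qed.

Lemma stein_divergence (p : 'cV[R]_d -> R) (phi : 'cV[R]_d -> 'cV[R]_d) x :
  differentiable p x -> 0 < p x -> differentiable phi x ->
  p x * stein p phi x = \sum_k partial k (fun z => p z * phi z k 0) x.
Proof.
move=> dp px dphi; rewrite /stein /divergence mxE mulrDr !mulr_sumr -big_split.
apply: eq_bigr => l _; rewrite /= !mxE (partial_ln l dp px).2 partialM//; last first.
  exact: differentiable_entry.
by field; rewrite gt_eqF.
Qed.

Lemma measurable_stein (p : 'cV[R]_d -> R) (phi : 'cV[R]_d -> 'cV[R]_d) :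
  (forall x, differentiable p x) -> (forall x, 0 < p x) ->
  (forall x, differentiable phi x) -> measurable_fun setT (stein p phi).
Proof.
move=> dp p0 dphi.
apply: (@eq_measurable_fun _ _ _ _ _ (fun x =>
    (\sum_l partial l (fun y => ln (p y)) x * phi x l 0) + divergence phi x)).
  move=> x _; rewrite /stein mxE; congr (_ + _).
  by apply: eq_bigr => l _; rewrite !mxE.
apply: measurable_funD; apply: measurable_sum => l.
  apply: measurable_funM.
    by apply: measurable_partial => x; exact: (partial_ln l (dp x) (p0 x)).1.
  by apply: differentiable_measurable => x; exact: differentiable_entry.
by apply: measurable_partial => x; exact: differentiable_entry.
Qed.

End stein.

(** * The Stein identity, pointwise, in expectation and for kernels *)

Section stein_transport.
Context {R : realType} {d : nat}.
Variables (t tinv : 'cV[R]_d -> 'cV[R]_d).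
Hypotheses (tK : cancel t tinv) (tinvK : cancel tinv t).
Hypotheses (tC1 : C1 t) (t_jac : forall x, nabla t x \in unitmx).
Variables (P P0 : probability 'cV[R]_d R) (p p0 : 'cV[R]_d -> R).
Hypotheses (Pp : is_density P p) (p_gt0 : forall x, 0 < p x).
Hypotheses (p_diff : forall x, differentiable p x).
Hypotheses (P0E : forall A, measurable A -> P0 A = pushforward P t A).
Hypotheses (P0p0 : is_density P0 p0) (p0_diff : forall y, differentiable p0 y).

Let asymptotics := density_stein_asymptotics tK tinvK tC1 t_jac Pp p_diff P0E P0p0 p0_diff.

(** The zero field satisfies the hypotheses of the asymptotics. If [p0] vanished at [t x], then
    [p x * a] would be at most every [e], although [a] is at least [c]. *)
Lemma pushforward_density_gt0 y : 0 < p0 y.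
Proof.
have d0 x : differentiable (cst 0 : 'cV[R]_d -> 'cV[R]_d) x by exact: differentiable_cst.
have dp x : differentiable (pullback_field t (cst 0 : 'cV[R]_d -> 'cV[R]_d)) x.
  rewrite (_ : pullback_field _ _ = cst 0)//.
  by apply/funext => z; rewrite /pullback_field mulmx0.
rewrite -(tinvK y); have [c c0 H] := asymptotics (tinv y) d0 dp.
have [_ p0_ge0 _] := P0p0.
rewrite lt_neqAle p0_ge0 andbT eq_sym; apply/eqP => p00.
have e0 : 0 < p (tinv y) * c / 2 by rewrite divr_gt0// mulr_gt0.
have [a [b [ca + _]]] := H _ e0; rewrite p00 mul0r subr0 => /(le_trans (ler_norm _)).
apply/negP; rewrite -ltNge; apply: (@lt_le_trans _ _ (p (tinv y) * c)).
  by rewrite ltr_pdivrMr// ltr_pMr ?mulr_gt0// ltr1n.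
by rewrite ler_pM2l.
Qed.

Lemma stein_pullback phi0 x : (forall y, differentiable phi0 y) ->
  (forall x, differentiable (pullback_field t phi0) x) ->
  stein p0 phi0 (t x) = stein p (pullback_field t phi0) x.
Proof.
move=> dphi0 dphi; have [c c0 H] := asymptotics x dphi0 dphi.
have px := p_gt0 x; have p0x := pushforward_density_gt0 (t x).
have E := stein_divergence (p_diff x) px (dphi x).
have E0 := stein_divergence (p0_diff (t x)) p0x (dphi0 (t x)).
move: H; rewrite -E -E0; set s := stein p _ x; set s0 := stein p0 _ _ => H.
apply/eqP; rewrite -subr_eq0 -normr_eq0; apply/eqP/le_anti; rewrite normr_ge0 andbT.
apply/ler_addgt0Pr => e e0; rewrite add0r.
(* Chosen so that the two errors [|s0| * (e * k)] and [e * k] add up to [e * (p x * c)]. The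
   identity [K] below combines the two estimates so that [b] cancels. *)
pose k := p x * c / (1 + `|s0|).
have k0 : 0 < k by rewrite divr_gt0 ?mulr_gt0// ltr_wpDr.
have [a [b [ca H1 H2]]] := H (e * k) (mulr_gt0 e0 k0).
have a0 : 0 < a by exact: lt_le_trans ca.
have K : p x * a * (s0 - s) = s0 * (p x * a - p0 (t x) * b) -
    (p x * s * a - p0 (t x) * s0 * b) by ring.
rewrite -(@ler_pM2l _ (p x * c)) ?mulr_gt0//.
apply: (@le_trans _ _ `|p x * a * (s0 - s)|).
  by rewrite normrM ler_wpM2r// gtr0_norm ?mulr_gt0// ler_pM2l.
rewrite K; apply: le_trans (ler_normB _ _) _; rewrite normrM.
apply: (@le_trans _ _ (`|s0| * (e * k) + e * k)); first by rewrite lerD// ler_wpM2l.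
rewrite le_eqVlt; apply/orP; left; apply/eqP; rewrite /k; field.
by rewrite gt_eqF// ltr_wpDr.
Qed.

Lemma expectation_stein (Q Q0 : probability 'cV[R]_d R) (phi0 : 'cV[R]_d -> 'cV[R]_d) :
  (forall A, measurable A -> Q0 A = pushforward Q t A) ->
  (forall y, differentiable phi0 y) ->
  (forall x, differentiable (pullback_field t phi0) x) ->
  ('E_Q0[stein p0 phi0] = 'E_Q[stein p (pullback_field t phi0)])%E.
Proof.
move=> Q0E dphi0 dphi; rewrite unlock.
rewrite (integral_image _ Q0E); last 2 first.
- exact: continuous_cV_measurable_map (continuous_t tC1).
- exact: measurable_stein p0_diff pushforward_density_gt0 dphi0.
by apply: eq_integral => x _; rewrite stein_pullback.
Qed.

(** Reduces the vector-valued drive of a kernel to scalar Stein operators, one for each row, with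
    the first argument of the kernel frozen. *)
Lemma kernel_row_stein (q : 'cV[R]_d -> R) (F : 'cV[R]_d -> 'M[R]_d) x l :
  stein q (fun z => (row l (F z))^T) x =
  (F x *m score q x + \col_k \sum_m partial m (fun z => F z k m) x) l 0.
Proof.
rewrite /stein /divergence !mxE; congr (_ + _).
  by apply: eq_bigr => m _; rewrite !mxE mulrC.
by apply: eq_bigr => m _; congr partial; apply/funext => z; rewrite !mxE.
Qed.

Lemma differentiable_row (F : 'cV[R]_d -> 'M[R]_d) (B : 'M[R]_d) x l :
  differentiable F x -> differentiable (fun z => (row l (B *m F z))^T) x.
Proof.
move=> dF.
pose L : {linear 'M[R]_d -> 'cV[R]_d} := trmx \o row l \o mulmx B.
have [k k0 Bk] := mulmx_bound B.
have cL : continuous L.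
  apply: (@bounded_linear_continuous R _ _ L k k0) => M /=.
  apply: mx_norm_le => [|i j]; first by rewrite mulr_ge0// ltW.
  by rewrite !mxE; apply: le_trans (Bk _ M); have := mx_norm_entry (B *m M) l i; rewrite mxE.
have dL : differentiable L (F x) by exact: linear_differentiable.
exact: (differentiable_comp dF dL).
Qed.

(** With [x] frozen, [phi0] is the transposed row [l] of [invmx J *m K0 (t x) w]. Its pullback
    multiplies by the inverse Jacobian at the second point, which after transposition is the right
    factor of the pulled-back kernel. The left factor [invmx J] is constant in the differentiation
    variable and moves out of the divergence. *)
Lemma kernel_drive (K0 : matrix_kernel R d)
    (K0_diff : forall x y, differentiable (K0 x) y)
    (K_diff : forall x y, differentiable (pullback_kernel t K0 x) y) x y :
  K0 (t x) (t y) *m score p0 (t y) + kernel_div K0 (t x) (t y) =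
  nabla t x *m (pullback_kernel t K0 x y *m score p y + kernel_div (pullback_kernel t K0) x y).
Proof.
set J := nabla t x; have uJ : J \in unitmx by exact: t_jac.
suff -> : pullback_kernel t K0 x y *m score p y + kernel_div (pullback_kernel t K0) x y =
    invmx J *m (K0 (t x) (t y) *m score p0 (t y) + kernel_div K0 (t x) (t y)).
  by rewrite mulKVmx.
apply/colP => l.
pose phi0 w := (row l (invmx J *m K0 (t x) w))^T.
have E : pullback_field t phi0 = fun z => (row l (pullback_kernel t K0 x z))^T.
  apply/funext => z; rewrite /pullback_field /phi0 /pullback_kernel -/J.
  by rewrite -[X in X *m _]trmxK -trmx_mul -row_mul.
have dphi0 w : differentiable phi0 w by exact: differentiable_row.
have dphi z : differentiable (pullback_field t phi0) z.
  rewrite E; have := differentiable_row 1%:M l (K_diff x z).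
  by rewrite (_ : (fun _ => _) = (fun z => (row l (pullback_kernel t K0 x z))^T))//;
    apply/funext => w; rewrite mul1mx.
have := stein_pullback y dphi0 dphi; rewrite E kernel_row_stein => <-.
rewrite kernel_row_stein mulmxDr mulmxA ![in LHS]mxE [in RHS]mxE.
congr (_ + _); first by rewrite mxE.
rewrite !mxE.
transitivity (\sum_m \sum_k invmx J l k * partial m (fun z => K0 (t x) z k m) (t y)).
  apply: eq_bigr => m _.
  have G : (fun z => (invmx J *m K0 (t x) z) l m) =
      \sum_(k < d) (invmx J l k *: (fun z => K0 (t x) z k m)).
    by apply/funext => z; rewrite mxE fct_sumE.
  transitivity (partial m (\sum_(k < d) (invmx J l k *: (fun z => K0 (t x) z k m))) (t y)).
    by rewrite -G.
  have D k : differentiable (fun z => K0 (t x) z k m) (t y) by exact: differentiable_entry.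
  rewrite /partial derive_sum => [|k]; last first.
    by apply: derivableZ; exact: diff_derivable.
  by apply: eq_bigr => k _; rewrite deriveZ//; exact: diff_derivable.
rewrite exchange_big; apply: eq_bigr => k _ /=.
by rewrite !mxE mulr_sumr.
Qed.

End stein_transport.

(** * Euler schemes of intertwined vector fields *)

Section compact_radius.
Context {R : realType} {E : normedModType R}.

(** Near-covering form of compactness: a property valid near each point of [K] for all small [i]
    holds on [K] with one threshold for [i]. *)
Lemma compact_radius (K : set E) (Q : R -> E -> Prop) : compact K ->
  (forall x, K x -> exists2 r : R, 0 < r &
    forall x' i, `|x' - x| < r -> 0 < i -> i < r -> Q i x') ->
  exists2 r : R, 0 < r & forall i, 0 < i -> i < r -> forall x, K x -> Q i x.
Proof.
move=> /compact_near_coveringP cK H.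
have := cK R (0 : R)^'+ Q _; case.
  move=> x Kx; have [r r0 Hr] := H x Kx.
  exists (ball x r, [set i : R | 0 < i < r]).
    split; first exact: nbhsx_ballx.
    near=> i; apply/andP; split; near: i.
      exact: nbhs_right_gt.
    exact: nbhs_right_lt.
  move=> [x' i] /= [xx' /andP[i0 ir]]; apply: Hr => //.
  by move: xx'; rewrite -ball_normE /= distrC.
move=> r /= r0 Hr; exists r => // i i0 ir x Kx; apply: Hr => //=.
by rewrite sub0r normrN gtr0_norm.
Unshelve. all: by end_near. Qed.

End compact_radius.

Section euler.
Context {R : realType} {E : normedModType R}.
Implicit Types (W : E -> E) (S : R -> E -> E) (K : set E) (X : R -> E).

(** Consistency of a one-step scheme in the sense of numerical analysis: local error [o(e)],
    uniformly on compact sets. *)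
Definition consistent S W := forall K, compact K -> forall eta : R, 0 < eta ->
  exists2 r : R, 0 < r & forall e u, 0 < e -> e < r -> K u ->
    `|S e u - u - e *: W u| <= eta * e.

Lemma locally_lipschitz_compact W K : compact K -> [locally [lipschitz W x | x in setT]] ->
  exists L r : R, [/\ 0 < L, 0 < r & forall c u v, K c -> `|u - c| < r -> `|v - c| < r ->
    `|W u - W v| <= L * `|u - v|].
Proof.
move=> cK lW.
(* The single parameter [i] serves as radius and, through [i^-1], as Lipschitz constant; both
   requirements weaken as [i] decreases, so [compact_radius] applies. *)
have [r r0 Hr] : exists2 r : R, 0 < r & forall i, 0 < i -> i < r -> forall x, K x ->
    forall u v, `|u - x| < i -> `|v - x| < i -> `|W u - W v| <= i^-1 * `|u - v|.
  apply: compact_radius => // x _.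
  have := lW (x, x) (conj I I); rewrite /lipschitz_on => -[M [_ HM]].
  have := HM (`|M| + 1) _; rewrite (le_lt_trans (ler_norm M)) ?ltrDl// => /(_ isT).
  move=> [[U1 U2] /= [/nbhs_ballP[r1 r10 Hr1] /nbhs_ballP[r2 r20 Hr2]] HU].
  have M1 : 0 < `|M| + 1 by rewrite ltr_wpDl.
  exists (Num.min (Num.min r1 r2 / 2) (`|M| + 1)^-1).
    by rewrite lt_min divr_gt0 ?lt_min ?r10//= invr_gt0.
  move=> x' i; rewrite !lt_min => /andP[xx' _] i0 /andP[ir iM] u v ux vx.
  have near_x w : `|w - x'| < i -> `|w - x| < Num.min r1 r2.
    move=> wx; rewrite -(subrKA x') (splitr (Num.min r1 r2)).
    apply: le_lt_trans (ler_normD _ _) _; apply: ltrD => //.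
    exact: lt_trans wx ir.
  have := HU (u, v); rewrite /dominated_by /= => HU'.
  apply: le_trans (HU' _ _) _ => //.
    split; [apply: Hr1|apply: Hr2]; rewrite -ball_normE /= distrC.
      by have := near_x u ux; rewrite lt_min => /andP[].
    by have := near_x v vx; rewrite lt_min => /andP[].
  by rewrite ler_wpM2r// -[leLHS]invrK lef_pV2 ?posrE ?invr_gt0// ltW.
have r20 : 0 < r / 2 by rewrite divr_gt0.
exists (r / 2)^-1, (r / 2); split => //; first by rewrite invr_gt0.
by move=> c u v Kc; apply: Hr => //; rewrite ltr_pdivrMr// ltr_pMr// ltr1n.
Qed.

Lemma locally_lipschitz_continuous W : [locally [lipschitz W x | x in setT]] -> continuous W.
Proof.
move=> lW x; apply/continuous_epsdelta => e e0.
have [L [r [L0 r0 H]]] := locally_lipschitz_compact (@compact_set1 _ x) lW.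
exists (Num.min r (e / L)); first by rewrite lt_min r0 divr_gt0.
move=> y; rewrite lt_min => /andP[yr ye].
have := H x y x erefl yr; rewrite subrr normr0 => /(_ r0) /le_lt_trans; apply.
by rewrite mulrC -ltr_pdivlMr.
Qed.

(** Separates the local errors of two schemes from the difference of their Euler steps. *)
Lemma subr_split (Z : zmodType) (p1 p2 p3 p4 p5 p6 : Z) :
  p1 - p2 = (p1 - p3 - p5) - (p2 - p4 - p6) + ((p3 - p4) + (p5 - p6)).
Proof.
rewrite (addrACA p3) -opprD -[p1 - p3 - p5]addrA -[p2 - p4 - p6]addrA -!opprD.
move: (p3 + p5) (p4 + p6) => Y W.
have -> : (p1 - Y) - (p2 - W) = (p1 - p2) - (Y - W).
  by rewrite (opprD p2) (opprD Y) !opprK addrACA.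
by rewrite subrK.
Qed.

(* Discrete Gronwall: only one of the two sequences is known to follow the curve. *)
Lemma euler_shadow W S S' K (T rho1 : R) X : compact K -> 0 < rho1 ->
  [locally [lipschitz W x | x in setT]] -> consistent S W -> consistent S' W ->
  (forall s u, 0 <= s -> s <= T -> `|u - X s| < rho1 -> K u) ->
  forall delta : R, 0 < delta -> exists rho r : R, [/\ 0 < rho, 0 < r & forall e u, 0 < e -> e < r ->
    (forall k : nat, k%:R * e <= T -> `|iter k (S e) u - X (k%:R * e)| < rho) ->
    forall k : nat, k%:R * e <= T -> `|iter k (S' e) u - X (k%:R * e)| < delta].
Proof.
move=> cK rho10 lW cS cS' KX delta delta0.
have [T0|T0] := ltP T 0.
  exists 1, 1; split => // e u e0 _ _ k kT.
  by have := le_lt_trans kT T0; rewrite ltNge mulr_ge0// ltW.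
have [L [r1 [L0 r10 lip]]] := locally_lipschitz_compact cK lW.
(* Bounds the Gronwall factor up to time [T]; [T + 1] keeps it positive at [T = 0]. With [eta]
   below, the accumulated error is at most [m / 4]. *)
pose C := 2 * (T + 1) * expR (L * T).
have C0 : 0 < C by rewrite !mulr_gt0 ?expR_gt0// ltr_wpDl.
(* Within [m] of the curve the goal is met, the Lipschitz bound holds and the point lies in [K].
   Half of [m] is for [a], half for the distance between [a] and [b]. *)
pose m := Num.min (Num.min delta r1) rho1.
have m0 : 0 < m by rewrite !lt_min delta0 r10.
pose eta := m / 4 / C; have eta0 : 0 < eta by rewrite /eta !divr_gt0.
have [r2 r20 H2] := cS K cK _ eta0; have [r3 r30 H3] := cS' K cK _ eta0.
exists (m / 2), (Num.min r2 r3); split; rewrite ?lt_min ?divr_gt0 ?r20//.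
move=> e u e0; rewrite lt_min => /andP[er2 er3] Ha.
set a := fun k => iter k (S e) u in Ha *; set b := fun k => iter k (S' e) u.
have gronwall (k : nat) : k%:R * e <= T -> 2 * eta * (k%:R * e) * (1 + L * e) ^+ k < m / 2.
  move=> kT; apply: (@le_lt_trans _ _ (2 * eta * T * expR (L * T))).
    have k0 : 0 <= k%:R * e by rewrite mulr_ge0// ltW.
    have L1 : 0 <= 1 + L * e by rewrite addr_ge0// mulr_ge0 ?(ltW L0) ?(ltW e0).
    have eta2 : 0 < 2 * eta by rewrite mulr_gt0.
    apply: ler_pM => //; first by apply: mulr_ge0 => //; exact: ltW.
    - exact: exprn_ge0.
    - by rewrite ler_pM2l.
    apply: (@le_trans _ _ (expR (L * e) ^+ k)).
      by rewrite lerXn2r ?nnegrE ?expR_ge0 ?expR_ge1Dx// addr_ge0// mulr_ge0// ltW.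
    by rewrite -expRM_natl ler_expR mulrCA ler_pM2l.
  have -> : m / 2 = eta * C + m / 4 by rewrite /eta divfK ?gt_eqF//; field.
  apply: (@le_lt_trans _ _ (eta * C)); last by rewrite ltrDl divr_gt0.
  have -> : 2 * eta * T * expR (L * T) = eta * (2 * T * expR (L * T)) by ring.
  by rewrite ler_pM2l// ler_pM2r ?expR_gt0// ler_pM2l// lerDl.
have K_near k v : k%:R * e <= T -> `|v - X (k%:R * e)| < m -> K v.
  move=> kT vm; apply: KX kT _; first by rewrite mulr_ge0// ltW.
  by apply: lt_le_trans vm _; rewrite /m ge_min lexx orbT.
have m_half v k : `|v - X (k%:R * e)| < m / 2 -> `|v - X (k%:R * e)| < m.
  by move=> /lt_trans; apply; rewrite ltr_pdivrMr// ltr_pMr// ltr1n.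
have b_near k : k%:R * e <= T -> `|a k - b k| <= 2 * eta * (k%:R * e) * (1 + L * e) ^+ k ->
    `|b k - X (k%:R * e)| < m.
  move=> kT D; rewrite -(subrKA (a k)) (splitr m).
  apply: le_lt_trans (ler_normD _ _) _; apply: ltrD; last exact: Ha.
  by rewrite distrC; apply: le_lt_trans D (gronwall k kT).
(* Each step adds at most [2 * eta * e] and multiplies the previous error by at most [1 + L * e].
   The bound at [k] also puts [b k] near the curve, where the estimates of the next step are
   valid. *)
have main k : k%:R * e <= T -> `|a k - b k| <= 2 * eta * (k%:R * e) * (1 + L * e) ^+ k.
  elim: k => [_|k IH kT].
    by rewrite subrr normr0 mul0r mulr0 mul0r.
  have kT' : k%:R * e <= T by apply: le_trans kT; rewrite ler_pM2r// ler_nat.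
  have {}IH := IH kT'; have bm := b_near k kT' IH; have am := m_half _ _ (Ha k kT').
  have Kx : K (X (k%:R * e)) by apply: (K_near k) => //; rewrite subrr normr0.
  have Ea := H2 e (a k) e0 er2 (K_near k _ kT' am).
  have Eb := H3 e (b k) e0 er3 (K_near k _ kT' bm).
  have r1m v : `|v - X (k%:R * e)| < m -> `|v - X (k%:R * e)| < r1.
    by move=> /lt_le_trans; apply; rewrite /m !ge_min lexx orbT.
  have EL := lip _ _ _ Kx (r1m _ am) (r1m _ bm).
  have -> : a k.+1 - b k.+1 = (S e (a k) - a k - e *: W (a k)) -
      (S' e (b k) - b k - e *: W (b k)) + ((a k - b k) + e *: (W (a k) - W (b k))).
    by rewrite /a /b !iterS scalerBr -subr_split.
  apply: le_trans (ler_normD _ _) _; apply: (@le_trans _ _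
      (2 * eta * e + (1 + L * e) * `|a k - b k|)).
    apply: lerD; first by apply: le_trans (ler_normB _ _) _; move: Ea Eb; lra.
    apply: le_trans (ler_normD _ _) _; rewrite mulrDl mul1r lerD2l normrZ gtr0_norm//.
    by rewrite -mulrA mulrCA ler_pM2l.
  have q1 : 1 <= 1 + L * e by rewrite lerDl mulr_ge0// ltW.
  have q0 : 0 < 1 + L * e by exact: lt_le_trans q1.
  apply: (@le_trans _ _ (2 * eta * e * (1 + L * e) ^+ k.+1 +
      (1 + L * e) * (2 * eta * (k%:R * e) * (1 + L * e) ^+ k))).
    apply: lerD; last by rewrite ler_pM2l.
    apply: ler_peMr; last exact: exprn_ege1.
    by apply: mulr_ge0; [apply: mulr_ge0 => //|]; exact: ltW.
  by rewrite exprS -natr1 le_eqVlt; apply/orP; left; apply/eqP; ring.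
move=> k kT; apply: lt_le_trans (b_near k kT (main k kT)) _.
by rewrite /m !ge_min lexx.
Qed.

Lemma consistent_euler W : consistent (fun e x => x + e *: W x) W.
Proof.
move=> K cK eta eta0; exists 1 => // e u e0 _ _.
rewrite addrAC addrK subrr normr0; apply: mulr_ge0; exact: ltW.
Qed.

End euler.

(** * Euler schemes conjugated by a diffeomorphism *)

Section conjugacy.
Context {R : realType} {E : normedModType R}.
Implicit Types (Phi Psi V : E -> E) (dPhi dPsi : E -> {linear E -> E}).

(** The fields are [Phi]-related in the sense of differential geometry. The derivative is strict, so
    that it varies continuously by [sdiff_near]. *)
Definition intertwines Phi dPhi V (V0 : E -> E) := [/\ forall x, sdiff Phi x (dPhi x),
  forall x, continuous (dPhi x) & forall x, V0 (Phi x) = dPhi x (V x)].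

Lemma intertwines_continuous Phi dPhi V V0 : intertwines Phi dPhi V V0 -> continuous Phi.
Proof.
move=> [sP cP _] x; apply: differentiable_continuous.
by have [] := fdiff_differentiable (cP x) (sdiff_fdiff (sP x)).
Qed.

(** At a nearby [z] the change of [V0 (Phi z)] splits into a change of [dPhi], applied to the
    bounded [V z], and [dPhi x] applied to [V z - V x]. *)
Lemma intertwines_continuous_field Phi dPhi Psi dPsi V V0 : cancel Psi Phi ->
  intertwines Phi dPhi V V0 -> intertwines Psi dPsi V0 V -> continuous V -> continuous V0.
Proof.
move=> PsiK iP iQ cV y.
have [sP cP VE] := iP.
have cQ := intertwines_continuous iQ.
have -> : V0 = (fun x => V0 (Phi x)) \o Psi by apply/funext => z /=; rewrite PsiK.
apply: continuous_comp; first exact: cQ.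
move: (Psi y) => {y} x; apply/continuous_epsdelta => e e0.
have [k k0 Ak] := linear_lipschitz (cP x).
have V1 : 0 < `|V x| + 1 by rewrite ltr_wpDl.
have e1 : 0 < e / 2 / (`|V x| + 1) by rewrite !divr_gt0.
have e2 : 0 < Num.min 1 (e / 2 / k) by rewrite lt_min ltr01 !divr_gt0.
have [r1 r10 H1] := sdiff_near (sP x) e1.
have [r2 r20 H2] := (continuous_epsdelta V x).1 (cV x) _ e2.
exists (Num.min r1 r2); first by rewrite lt_min r10.
move=> z; rewrite lt_min => /andP[zr1 zr2]; rewrite !VE.
have := H2 z zr2; rewrite lt_min => /andP[Vz1 Vz2].
rewrite -(subrKA (dPhi x (V z))) (splitr e) -linearB.
apply: le_lt_trans (ler_normD _ _) _; apply: ler_ltD.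
  apply: le_trans (H1 z _ zr1 (sdiff_fdiff (sP z)) _) _.
  rewrite -[leRHS](divfK (lt0r_neq0 V1)) ler_pM2l//.
  rewrite -(subrK (V x) (V z)); apply: le_trans (ler_normD _ _) _.
  by rewrite addrC lerD2l ltW.
by apply: le_lt_trans (Ak _) _; rewrite mulrC -ltr_pdivlMr.
Qed.

(** Linearizing at a fixed centre [x] instead of at [u] gives one radius for all [u] near [x], as
    compactness requires. The three thirds of [eta] pay for the strict remainder, for [V u - V x]
    and for [V0 (Phi x) - V0 (Phi u)]. *)
Lemma intertwines_step_uniform Phi dPhi V V0 : intertwines Phi dPhi V V0 ->
  continuous V -> continuous V0 ->
  forall K, compact K -> forall eta : R, 0 < eta -> exists2 r : R, 0 < r &
    forall e u, 0 < e -> e < r -> K u ->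
    `|Phi (u + e *: V u) - (Phi u + e *: V0 (Phi u))| <= eta * e.
Proof.
move=> iP cV cV0 K cK eta eta0; have [sP cP VE] := iP.
have cPhi := intertwines_continuous iP.
have [|r r0 H] := @compact_radius R E K
  (fun e u => `|Phi (u + e *: V u) - (Phi u + e *: V0 (Phi u))| <= eta * e) cK.
  move=> x Kx.
  have [k k0 Ak] := linear_lipschitz (cP x).
  have V1 : 0 < `|V x| + 1 by rewrite ltr_wpDl.
  have e1 : 0 < eta / 3 / (`|V x| + 1) by rewrite !divr_gt0.
  have e2 : 0 < Num.min 1 (eta / 3 / k) by rewrite lt_min ltr01 !divr_gt0.
  have e3 : 0 < eta / 3 by rewrite divr_gt0.
  have [r1 r10 H1] := sP x _ e1.
  have [r2 r20 H2] := (continuous_epsdelta V x).1 (cV x) _ e2.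
  have cV0Phi : {for x, continuous (V0 \o Phi)}.
    by apply: continuous_comp; [exact: cPhi|exact: cV0].
  have [r3 r30 H3] := (continuous_epsdelta (V0 \o Phi) x).1 cV0Phi _ e3.
  pose r := Num.min (r1 / 2) (r1 / 2 / (`|V x| + 1)).
  have r0 : 0 < r by rewrite lt_min !divr_gt0.
  exists (Num.min r (Num.min r2 r3)); first by rewrite lt_min r0 lt_min r20.
  move=> u e; rewrite !lt_min => /and3P[/andP[ur1 _] ur2 ur3] e0 /and3P[/andP[_ er] _ _].
  have := H2 u ur2; rewrite lt_min => /andP[Vu1 Vu2].
  have Vu : `|V u| <= `|V x| + 1.
    rewrite -(subrK (V x) (V u)); apply: le_trans (ler_normD _ _) _.
    by rewrite addrC lerD2l ltW.
  have eVu : `|e *: V u| <= e * (`|V x| + 1) by rewrite normrZ gtr0_norm// ler_pM2l.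
  have ur : `|u - x| < r1.
    by apply: lt_trans ur1 _; rewrite ltr_pdivrMr// ltr_pMr// ltr1n.
  have ur' : `|u + e *: V u - x| < r1.
    rewrite addrAC (splitr r1); apply: le_lt_trans (ler_normD _ _) _; apply: ltrD => //.
    by apply: le_lt_trans eVu _; rewrite -ltr_pdivlMr.
  have := H1 _ _ ur' ur; rewrite (addrC u) addrK => H1'.
  have -> : Phi (e *: V u + u) - (Phi u + e *: V0 (Phi u)) =
      (Phi (e *: V u + u) - Phi u - dPhi x (e *: V u)) +
      e *: (dPhi x (V u - V x) + (V0 (Phi x) - V0 (Phi u))).
    have LZ : dPhi x (e *: V u) = e *: dPhi x (V u) by rewrite linearZ.
    rewrite (VE x) (linearB (dPhi x)) subrKA scalerBr -LZ opprD addrA.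
    by rewrite [RHS]subrKA.
  apply: le_trans (ler_normD _ _) _.
  have b1 : `|Phi (e *: V u + u) - Phi u - dPhi x (e *: V u)| <= eta / 3 * e.
    apply: le_trans H1' _.
    apply: (@le_trans _ _ (eta / 3 / (`|V x| + 1) * (e * (`|V x| + 1)))).
      by rewrite ler_pM2l.
    by rewrite mulrCA divfK ?gt_eqF// mulrC.
  have b2 : `|dPhi x (V u - V x)| <= eta / 3.
    apply: le_trans (Ak _) _; rewrite mulrC -ler_pdivlMr//; exact: ltW.
  have b3 : `|V0 (Phi x) - V0 (Phi u)| <= eta / 3.
    by rewrite distrC ltW//; exact: H3.
  rewrite normrZ (gtr0_norm e0).
  have b4 := le_trans (ler_normD (dPhi x (V u - V x)) (V0 (Phi x) - V0 (Phi u))) (lerD b2 b3).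
  have b5 : e * `|dPhi x (V u - V x) + (V0 (Phi x) - V0 (Phi u))| <= e * (eta / 3 + eta / 3).
    by rewrite ler_pM2l.
  apply: le_trans (lerD b1 b5) _.
  have -> : eta / 3 * e + e * (eta / 3 + eta / 3) = eta * e by field.
  exact: lexx.
by exists r => // e u e0 er Ku; exact: H.
Qed.

Definition euler V (e : R) := fun x => x + e *: V x.

(** A step of [V0], seen through [Psi], is a perturbed Euler step of [V]. Its iterates are the
    images under [Psi] of those of [V0], which makes both schemes comparable in one space. *)
Lemma consistent_conjugate Phi dPhi Psi dPsi V V0 : cancel Phi Psi ->
  intertwines Phi dPhi V V0 -> intertwines Psi dPsi V0 V -> continuous V -> continuous V0 ->
  consistent (fun e u => Psi (euler V0 e (Phi u))) V.
Proof.
move=> PhiK iP iQ cV cV0 K cK eta eta0.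
have cPhi := intertwines_continuous iP.
have cK' : compact (Phi @` K).
  by apply: continuous_compact => //; exact: continuous_subspaceT.
have [r r0 H] := intertwines_step_uniform iQ cV0 cV cK' eta0.
exists r => // e u e0 er Ku.
have := H e (Phi u) e0 er _; rewrite PhiK opprD addrA; apply.
by exists u.
Qed.

Lemma iter_conjugate Phi Psi (V0 : E -> E) (e : R) u k : cancel Phi Psi -> cancel Psi Phi ->
  iter k (fun u => Psi (euler V0 e (Phi u))) u = Psi (iter k (euler V0 e) (Phi u)).
Proof. by move=> PhiK PsiK; elim: k => [|k IH] /=; rewrite ?PhiK// IH PsiK. Qed.

Definition euler_limit V (T : R) (X : R -> E) :=
  {within `[0, T], continuous X} /\
  forall e : R, 0 < e -> \forall eps \near 0^'+, forall k : nat,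
    k%:R * eps <= T -> `|iter k (euler V eps) (X 0) - X (k%:R * eps)| < e.

(** Stronger than uniform continuity on [K]: the point [u] may lie outside [K]. *)
Lemma compact_modulus Phi K (d0 : R) : continuous Phi -> compact K -> 0 < d0 ->
  exists2 r : R, 0 < r & forall x u, K x -> `|u - x| < r -> `|Phi u - Phi x| < d0.
Proof.
move=> cPhi cK d00; have d2 : 0 < d0 / 2 by rewrite divr_gt0.
have [|r r0 H] := @compact_radius R E K
  (fun i x => forall u, `|u - x| < i -> `|Phi u - Phi x| < d0) cK.
  move=> x Kx; have [r r0 H] := (continuous_epsdelta Phi x).1 (cPhi x) _ d2.
  exists (r / 2); first by rewrite divr_gt0.
  move=> x' i xx' i0 ir u ux.
  rewrite -(subrKA (Phi x)) (splitr d0); apply: le_lt_trans (ler_normD _ _) _.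
  apply: ltrD.
    apply: H; rewrite -(subrKA x') (splitr r); apply: le_lt_trans (ler_normD _ _) _.
    by apply: ltrD => //; exact: lt_trans ir.
  rewrite distrC; apply: H; apply: lt_trans xx' _.
  by rewrite ltr_pdivrMr// ltr_pMr// ltr1n.
exists (r / 2); first by rewrite divr_gt0.
move=> x u Kx; apply: H => //; first by rewrite divr_gt0.
by rewrite ltr_pdivrMr// ltr_pMr// ltr1n.
Qed.

(** Finite dimension, stated for the abstract [E]; [bounded_matrix_subset_compact] provides it for
    particle configurations. *)
Hypothesis bounded_subset_compact : forall M : R, exists2 K : set E, compact K & forall x, `|x| <= M -> K x.

Let tube (T : R) (X : R -> E) : {within `[0, T], continuous X} ->
  exists2 N : set E, compact N &
    forall s u, 0 <= s -> s <= T -> `|u - X s| < 1 -> N u.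
Proof.
move=> cX; have cI := continuous_compact cX (@segment_compact _ 0 T).
have [M [Mr HM]] := compact_bounded cI.
have [N cN NP] := bounded_subset_compact (`|M| + 1 + 1).
exists N => // s u s0 sT us; apply: NP.
rewrite -(subrK (X s) u) addrC; apply: le_trans (ler_normD _ _) _; apply: lerD; last exact: ltW.
apply: HM; first by rewrite (le_lt_trans (ler_norm M))// ltrDl.
by exists s => //=; rewrite in_itv /= s0.
Qed.

Lemma euler_limit_transfer Phi dPhi Psi dPsi V V0 (T : R) (X : R -> E) :
  cancel Phi Psi -> cancel Psi Phi ->
  intertwines Phi dPhi V V0 -> intertwines Psi dPsi V0 V ->
  [locally [lipschitz V x | x in setT]] \/ [locally [lipschitz V0 x | x in setT]] ->
  euler_limit V T X -> euler_limit V0 T (Phi \o X).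
Proof.
move=> PhiK PsiK iP iQ lV [cX HX].
have cPhi := intertwines_continuous iP.
have cPsi := intertwines_continuous iQ.
have [cV cV0] : continuous V /\ continuous V0.
  case: lV => /locally_lipschitz_continuous c; split=> //.
    exact: intertwines_continuous_field PsiK iP iQ c.
  exact: intertwines_continuous_field PhiK iQ iP c.
have cPX : {within `[0, T], continuous (Phi \o X)}.
  by move=> s; apply: (continuous_comp (cX s)); exact: cPhi.
split=> // d0 d00.
have [N cN NP] := tube cX.
have NX s : 0 <= s -> s <= T -> N (X s).
  by move=> s0 sT; apply: (NP s) => //; rewrite subrr normr0.
case: lV => lV.
  (* [V] is locally Lipschitz: the conjugated scheme of [V0] shadows the Euler scheme of [V] along
     [X], and [Phi] carries the closeness over. *)
  have [r1 r10 H1] := compact_modulus cPhi cN d00.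
  have [rho [r [rho0 r0 H]]] := euler_shadow cN ltr01 lV (@consistent_euler _ _ V)
    (consistent_conjugate PhiK iP iQ cV cV0) NP r10.
  have Hrho := HX rho rho0.
  near=> eps => k kT.
  have eps0 : 0 < eps by near: eps; exact: nbhs_right_gt.
  have epsr : eps < r by near: eps; exact: nbhs_right_lt.
  have Heps : forall k : nat, k%:R * eps <= T ->
    `|iter k (euler V eps) (X 0) - X (k%:R * eps)| < rho by near: eps.
  have := H eps (X 0) eps0 epsr Heps k kT; rewrite iter_conjugate// => K.
  have := H1 (X (k%:R * eps)) _ (NX _ _ kT) K; rewrite PsiK; apply.
  by rewrite mulr_ge0// ltW.
(* [V0] is locally Lipschitz: the known scheme of [V] is first carried over by [Phi], and the Euler
   scheme of [V0] shadows it along [Phi \o X]. *)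
have [N' cN' NP'] := tube cPX.
have [rho [r [rho0 r0 H]]] := euler_shadow cN' ltr01 lV
  (consistent_conjugate PsiK iQ iP cV0 cV) (@consistent_euler _ _ V0) NP' d00.
have [r1 r10 H1] := compact_modulus cPhi cN rho0.
have Hr1 := HX r1 r10.
near=> eps => k kT.
have eps0 : 0 < eps by near: eps; exact: nbhs_right_gt.
have epsr : eps < r by near: eps; exact: nbhs_right_lt.
have Heps : forall k : nat, k%:R * eps <= T ->
  `|iter k (euler V eps) (X 0) - X (k%:R * eps)| < r1 by near: eps.
apply: (H eps (Phi (X 0)) eps0 epsr) => // j jT; rewrite iter_conjugate// PhiK.
by apply: H1; [apply: NX => //; rewrite mulr_ge0// ltW|exact: Heps].
Unshelve. all: by end_near. Qed.

End conjugacy.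

(** * Particle configurations *)

Section particles.
Context {R : realType} {d n : nat}.
Implicit Types (f : 'cV[R]_d -> 'cV[R]_d) (J : 'cV[R]_d -> 'M[R]_d) (X V : 'M[R]_(d, n)).

(** The derivative of [on_particles f] at [X] when [J] is the Jacobian of [f]: block diagonal, one
    block per particle. *)
Definition mul_particles J X V : 'M[R]_(d, n) := \matrix_(l, i) (J (col i X) *m col i V) l 0.

Lemma mul_particles_is_linear J X : linear (mul_particles J X).
Proof.
move=> a V W; apply/matrixP => l i; rewrite !mxE mulr_sumr -big_split /=.
by apply: eq_bigr => k _; rewrite !mxE; ring.
Qed.

HB.instance Definition _ J X := GRing.isLinear.Build R 'M[R]_(d, n) 'M[R]_(d, n) _
  (mul_particles J X) (mul_particles_is_linear J X).

Lemma mul_particles_continuous J X : continuous (mul_particles J X).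
Proof.
have [k k0 Hk] : exists2 k : R, 0 < k & forall V, `|mul_particles J X V| <= k * `|V|.
  exists (\sum_i d%:R * `|J (col i X)| + 1).
    by rewrite ltr_wpDl// sumr_ge0// => i _; rewrite mulr_ge0.
  move=> V; apply: mx_norm_le => [|l i].
    by rewrite mulr_ge0// addr_ge0// sumr_ge0// => i _; rewrite mulr_ge0.
  rewrite mxE; apply: le_trans (mx_norm_entry _ _ _) _.
  apply: le_trans (norm_mulmx _ _) _; apply: ler_pM; rewrite ?mulr_ge0//; last exact: norm_col.
  apply: (@le_trans _ _ (\sum_i d%:R * `|J (col i X)|)); last by rewrite lerDl.
  by rewrite (bigD1 i)//= lerDl sumr_ge0// => j _; exact: mulr_ge0.
exact: (@bounded_linear_continuous R _ _ (mul_particles J X) k k0 Hk).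
Qed.

Lemma col_on_particles f X i : col i (on_particles f X) = f (col i X).
Proof. by apply/colP => l; rewrite !mxE. Qed.

Lemma on_particlesK f g : cancel f g -> cancel (on_particles f) (@on_particles R d n g).
Proof.
by move=> fK X; apply/matrixP => l i; rewrite mxE col_on_particles fK mxE.
Qed.

Lemma sdiff_on_particles f J X : (forall x, sdiff f x (mulmx (J x))) ->
  sdiff (on_particles f) X (mul_particles J X).
Proof.
move=> sf e e0.
have [r r0 H] : exists2 r : R, 0 < r & forall (i : 'I_n) u v,
    `|u - col i X| < r -> `|v - col i X| < r ->
    `|f u - f v - J (col i X) *m (u - v)| <= e * `|u - v|.
  apply: common_radius => [i r r' rr' H u v ur vr|i]; last exact: sf.
  by apply: H; [exact: lt_le_trans ur _|exact: lt_le_trans vr _].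
exists r => // U V Ur Vr; apply: mx_norm_le => [|l i]; first by rewrite mulr_ge0// ltW.
have colB (Y Z : 'M[R]_(d, n)) : col i Y - col i Z = col i (Y - Z).
  by apply/colP => k; rewrite !mxE.
have -> : (on_particles f U - on_particles f V - mul_particles J X (U - V)) l i =
    (f (col i U) - f (col i V) - J (col i X) *m (col i U - col i V)) l 0.
  by rewrite colB !mxE.
apply: le_trans (mx_norm_entry _ _ _) _.
apply: le_trans (H i _ _ _ _) _; rewrite ?colB.
- exact: le_lt_trans (norm_col _ _) Ur.
- exact: le_lt_trans (norm_col _ _) Vr.
- by rewrite ler_pM2l// norm_col.
Qed.

(** Flattening by [mxvec] turns a ball into a product of segments. *)
Lemma bounded_matrix_subset_compact (M : R) :
  exists2 K : set 'M[R]_(d, n), compact K & forall X, `|X| <= M -> K X.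
Proof.
pose B := [set v : 'rV[R]_(d * n) | forall i, (fun=> `[- M, M]%classic) i (v ord0 i)].
have cB : compact B by apply: rV_compact => _; exact: segment_compact.
have cvec : continuous (vec_mx : 'rV[R]_(d * n) -> 'M[R]_(d, n)).
  apply: (@bounded_linear_continuous R _ _ (vec_mx : {linear _ -> _}) 1 ltr01) => v.
  by rewrite mul1r; apply: mx_norm_le => // i j; rewrite mxE; exact: mx_norm_entry.
exists (vec_mx @` B).
  by apply: continuous_compact => //; exact: continuous_subspaceT.
move=> X XM; exists (mxvec X); last exact: mxvecK.
move=> k /=; case/mxvec_indexP: k => i j; rewrite mxvecE in_itv /= -ler_norml.
exact: le_trans (mx_norm_entry _ _ _) XM.
Qed.

End particles.

(** * Continuous-time trajectories and single steps *)

Section flows.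
Context {R : realType} {E : normedModType R}.

Lemma is_derive_intertwines (Phi V V0 : E -> E) (dPhi : E -> {linear E -> E}) (X : R -> E) s :
  intertwines Phi dPhi V V0 -> is_derive s (1 : R) X (V (X s)) ->
  is_derive s (1 : R) (Phi \o X) (V0 ((Phi \o X) s)).
Proof.
move=> [sP cP VE] [dX XE].
have DX : differentiable X s by apply/derivable1_diffP.
have [DP PE] := fdiff_differentiable (cP (X s)) (sdiff_fdiff (sP (X s))).
have D : differentiable (Phi \o X) s by exact: differentiable_comp.
apply: DeriveDef; first exact: diff_derivable.
have C := diff_comp DX DP.
rewrite (deriveE _ D) /= VE -XE (deriveE _ DX) -PE.
exact: (congr1 (fun F => F (1 : R)) C).
Qed.

Definition flow (V : E -> E) (T : R) (X : R -> E) :=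
  {within `[0, T], continuous X} /\
  forall s, s \in `]0, T[ -> is_derive s (1 : R) X (V (X s)).

Lemma flow_intertwines (Phi V V0 : E -> E) (dPhi : E -> {linear E -> E}) (T : R) (X : R -> E) :
  intertwines Phi dPhi V V0 -> flow V T X -> flow V0 T (Phi \o X).
Proof.
move=> iP [cX dX]; have cPhi := intertwines_continuous iP; split.
  by move=> s; apply: (continuous_comp (cX s)); exact: cPhi.
by move=> s sT; apply: is_derive_intertwines iP _; exact: dX.
Qed.

(** As [V0 (Phi x)] is [dPhi x (V x)], the difference of the two steps is exactly the first-order
    remainder of [Phi] along [e *: V x]. *)
Lemma step_intertwines (Phi V V0 : E -> E) (dPhi : E -> {linear E -> E}) (x : E) :
  intertwines Phi dPhi V V0 ->
  (fun e : R => e^-1 *: (Phi (x + e *: V x) - (Phi x + e *: V0 (Phi x)))) @ 0^'+ --> (0 : E).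
Proof.
move=> [sP cP VE]; apply/cvgrPdist_le => e e0.
have V1 : 0 < `|V x| + 1 by rewrite ltr_wpDl.
have e1 : 0 < e / (`|V x| + 1) by rewrite divr_gt0.
have [r r0 H] := sdiff_fdiff (sP x) e1.
have rV : 0 < r / (`|V x| + 1) by rewrite divr_gt0.
near=> eps.
have eps0 : 0 < eps by near: eps; exact: nbhs_right_gt.
have epsr : eps < r / (`|V x| + 1) by near: eps; exact: nbhs_right_lt.
have eV : `|eps *: V x| <= eps * (`|V x| + 1).
  by rewrite normrZ gtr0_norm// ler_pM2l// lerDl.
have := H (eps *: V x); rewrite (le_lt_trans eV) => [/(_ isT)|]; last first.
  by rewrite -ltr_pdivlMr.
rewrite linearZ => H'; have ie0 : 0 < eps^-1 by rewrite invr_gt0.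
rewrite sub0r normrN normrZ (gtr0_norm ie0) VE opprD addrA.
rewrite -ler_pdivlMl ?invr_gt0// invrK; apply: le_trans H' _.
apply: le_trans (ler_wpM2l (ltW e1) eV) _.
by rewrite mulrCA divfK ?gt_eqF// mulrC.
Unshelve. all: by end_near. Qed.

End flows.

Section svgd.
Context {R : realType} {d : nat}.

Lemma pullback_pd_kernel (t : 'cV[R]_d -> 'cV[R]_d) (K0 : matrix_kernel R d) :
  pd_kernel K0 -> pd_kernel (pullback_kernel t K0).
Proof.
move=> [K0_sym K0_pos]; split=> [x x'|N x c].
  by rewrite /pullback_kernel !trmx_mul trmxK -K0_sym mulmxA.
(* The transposed inverse Jacobians are moved onto the coefficients [c]. *)
apply: le_trans (K0_pos N (t \o x) (fun i => (invmx (nabla t (x i)))^T *m c i)) _.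
rewrite le_eqVlt; apply/orP; left; apply/eqP.
apply: eq_bigr => i _; apply: eq_bigr => j _; congr (fun_of_matrix _ 0 0).
by rewrite /pullback_kernel trmx_mul trmxK !mulmxA.
Qed.

Lemma svgd_direction_intertwined n (t : 'cV[R]_d -> 'cV[R]_d) (J : 'cV[R]_d -> 'M[R]_d)
    (p p0 : 'cV[R]_d -> R) (K K0 : matrix_kernel R d) :
  (forall x y, K0 (t x) (t y) *m score p0 (t y) + kernel_div K0 (t x) (t y) =
    J x *m (K x y *m score p y + kernel_div K x y)) ->
  forall X : 'M[R]_(d, n), svgd_direction p0 K0 (on_particles t X) =
    mul_particles J X (svgd_direction p K X).
Proof.
move=> H X; apply/matrixP => l i; rewrite [RHS]mxE.
have -> : col i (svgd_direction p K X) = n%:R^-1 *: \sum_(j < n)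
    (K (col i X) (col j X) *m score p (col j X) + kernel_div K (col i X) (col j X)).
  exact: col_on_particles.
rewrite mxE col_on_particles -scalemxAr mulmx_sumr; congr (fun_of_matrix (_ *: _) l 0).
by apply: eq_bigr => j _; rewrite col_on_particles H.
Qed.

End svgd.

Theorem theorem3 (R : realType) (d : nat)
    (t tinv : 'cV[R]_d -> 'cV[R]_d)
    (tK : cancel t tinv) (tinvK : cancel tinv t)
    (tC1 : C1 t) (t_jac : forall x, nabla t x \in unitmx)
    (P P0 : probability 'cV[R]_d R) (p p0 : 'cV[R]_d -> R)
    (Pp : is_density P p) (p_gt0 : forall x, 0 < p x) (pC1 : C1 p)
    (P0E : forall A, measurable A -> P0 A = pushforward P t A)
    (P0p0 : is_density P0 p0) (p0_diff : forall y, differentiable p0 y) :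
  (forall (Q Q0 : probability 'cV[R]_d R)
      (Q0E : forall A, measurable A -> Q0 A = pushforward Q t A)
      (phi0 : 'cV[R]_d -> 'cV[R]_d)
      (phi0_diff : forall y, differentiable phi0 y)
      (phi_diff : forall x, differentiable (pullback_field t phi0) x),
    'E_Q0[stein p0 phi0] = 'E_Q[stein p (pullback_field t phi0)])%E
  /\
  (forall (K0 : matrix_kernel R d) (K0_pd : pd_kernel K0)
      (K0_diff : forall x y, differentiable (K0 x) y)
      (K_diff : forall x y, differentiable (pullback_kernel t K0 x) y),
    let K := pullback_kernel t K0 in
    pd_kernel K /\
    forall n : nat,
    [/\ (* one update with step eps agrees through t, and through its inverse,
           up to o(eps) as eps tends to 0+ *)
        (forall X : 'M[R]_(d, n),
          (fun eps : R => eps^-1 *: (on_particles t (svgd_step p K eps X)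
             - svgd_step p0 K0 eps (on_particles t X))) @ 0^'+ -->
            (0 : 'M[R]_(d, n))) /\
        (forall Y : 'M[R]_(d, n),
          (fun eps : R => eps^-1 *: (on_particles tinv (svgd_step p0 K0 eps Y)
             - svgd_step p K eps (on_particles tinv Y))) @ 0^'+ -->
            (0 : 'M[R]_(d, n))),
        (* continuous-time trajectories *)
        forall T : R,
          (forall X : R -> 'M[R]_(d, n),
            svgd_flow p K T X <->
            svgd_flow p0 K0 T (fun s => on_particles t (X s))) /\
          (forall Y : R -> 'M[R]_(d, n),
            svgd_flow p0 K0 T Y <->
            svgd_flow p K T (fun s => on_particles tinv (Y s))) &
        (* limits of the discrete trajectories as eps tends to 0+ *)
        locally_lipschitz (svgd_direction p K : 'M[R]_(d, n) -> 'M[R]_(d, n)) \/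
        locally_lipschitz (svgd_direction p0 K0 : 'M[R]_(d, n) -> 'M[R]_(d, n)) ->
        forall T : R,
          (forall X : R -> 'M[R]_(d, n),
            svgd_limit p K T X <->
            svgd_limit p0 K0 T (fun s => on_particles t (X s))) /\
          (forall Y : R -> 'M[R]_(d, n),
            svgd_limit p0 K0 T Y <->
            svgd_limit p K T (fun s => on_particles tinv (Y s)))]).

Proof.
have p_diff x : differentiable p x := pC1.1 x.
split=> [Q Q0 Q0E phi0 phi0_diff phi_diff|K0 K0_pd K0_diff K_diff K].
  exact: (expectation_stein tK tinvK tC1 t_jac Pp p_gt0 p_diff P0E P0p0 p0_diff).
split=> [|n]; first exact: pullback_pd_kernel.
(* The derivative of [tinv] at [y]. It makes [tinv] intertwine the fields in the opposite direction,
   so every transport statement is applied twice; the converse implications follow from the opposite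
   transport and cancellation. *)
pose Jinv y := invmx (nabla t (tinv y)).
have drive := kernel_drive tK tinvK tC1 t_jac Pp p_gt0 p_diff P0E P0p0 p0_diff K0_diff K_diff.
have sinv y : sdiff tinv y (mulmx (Jinv y)).
  by have := @sdiff_tinv _ _ _ _ tK tC1 t_jac (tinv y); rewrite tinvK.
have PhiK := @on_particlesK R d n _ _ tK.
have PsiK := @on_particlesK R d n _ _ tinvK.
pose V : 'M[R]_(d, n) -> 'M[R]_(d, n) := svgd_direction p K.
pose V0 : 'M[R]_(d, n) -> 'M[R]_(d, n) := svgd_direction p0 K0.
pose dPhi (X : 'M[R]_(d, n)) : {linear 'M[R]_(d, n) -> 'M[R]_(d, n)} := mul_particles (nabla t) X.
pose dPsi (X : 'M[R]_(d, n)) : {linear 'M[R]_(d, n) -> 'M[R]_(d, n)} := mul_particles Jinv X.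
have iP : intertwines (on_particles t) dPhi V V0.
  split=> [X|X|X].
  - by apply: sdiff_on_particles => x; exact: C1_sdiff.
  - exact: mul_particles_continuous.
  - exact: svgd_direction_intertwined.
have iQ : intertwines (on_particles tinv) dPsi V0 V.
  split=> [X|X|X].
  - exact: sdiff_on_particles.
  - exact: mul_particles_continuous.
  - apply: svgd_direction_intertwined => x y.
    have := drive (tinv x) (tinv y); rewrite !tinvK => ->.
    by rewrite /Jinv mulKmx.
have back (X : R -> 'M[R]_(d, n)) :
    (fun s => on_particles tinv (on_particles t (X s))) = X.
  by apply/funext => s; rewrite PhiK.
have back0 (Y : R -> 'M[R]_(d, n)) :
    (fun s => on_particles t (on_particles tinv (Y s))) = Y.
  by apply/funext => s; rewrite PsiK.
split.
- split=> [X|Y]; first exact: (step_intertwines X iP).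
  exact: (step_intertwines Y iQ).
- move=> T.
  have fwd (X : R -> 'M[R]_(d, n)) : svgd_flow p K T X -> svgd_flow p0 K0 T (fun s => on_particles t (X s)).
    exact: (flow_intertwines iP).
  have bwd (Y : R -> 'M[R]_(d, n)) : svgd_flow p0 K0 T Y -> svgd_flow p K T (fun s => on_particles tinv (Y s)).
    exact: (flow_intertwines iQ).
  split=> [X|Y]; split; [exact: fwd| |exact: bwd|].
    by move/bwd; rewrite back.
  by move/fwd; rewrite back0.
- move=> lV T.
  have compact_balls := @bounded_matrix_subset_compact R d n.
  have lV' : [locally [lipschitz V0 x | x in setT]] \/ [locally [lipschitz V x | x in setT]].
    by case: lV; [right|left].
  have fwd (X : R -> 'M[R]_(d, n)) : svgd_limit p K T X -> svgd_limit p0 K0 T (fun s => on_particles t (X s)).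
    by move=> HX; exact: (euler_limit_transfer compact_balls PhiK PsiK iP iQ lV HX).
  have bwd (Y : R -> 'M[R]_(d, n)) : svgd_limit p0 K0 T Y -> svgd_limit p K T (fun s => on_particles tinv (Y s)).
    by move=> HY; exact: (euler_limit_transfer compact_balls PsiK PhiK iQ iP lV' HY).
  split=> [X|Y]; split; [exact: fwd| |exact: bwd|].
    by move/bwd; rewrite back.
  by move/fwd; rewrite back0.
Qed.
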